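(* Let $k$ be an algebraically closed field of characteristic $p>0$ and let $n\ge1$. Let $G\subset\mathrm{PGL}(n+2,k)$ be a subgroup isomorphic to a semidirect product $(\mathbb Z/p\mathbb Z)^{\oplus u}\rtimes\mathbb Z/l\mathbb Z$, where $u\ge1$, $l\ge1$, and $\gcd(p,l)=1$ if $l\ge2$. Then the following statements hold: (1) The group $G$ is liftable. (2) There exists an irreducible hypersurface $\mathcal X\subset\mathbb P^{n+1}$ of degree at least $3$ with an extendable wild Galois point $P\in\mathbb P^{n+1}$ such that $G$ is the Galois group of the projection $\pi_P\colon\mathcal X\dashrightarrow\mathbb P^n$ if and only if there exists a subgroup $G'\subset\mathrm{GL}(n+2,k)$ such that $pr|_{G'}\colon G'\to G$ is an isomorphism and $G'$ satisfies the following two conditions: (i) $\dim\mathrm{Im}(A-I_{n+2})=1$ for some $A\in G'$; (ii) $\mathrm{Im}(B-I_{n+2})=\mathrm{Im}(C-I_{n+2})$ for all $B,C\in G'\setminus\{I_{n+2}\}$.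
   Context: $pr\colon\mathrm{GL}(r,k)\to\mathrm{PGL}(r,k)$, $A\mapsto[A]$, is the natural projection (quotient by nonzero scalar matrices) and $I_r$ is the identity matrix. A subgroup $G\subset\mathrm{PGL}(r,k)$ is liftable if there is a subgroup $G'\subset\mathrm{GL}(r,k)$ such that $pr|_{G'}\colon G'\to G$ is an isomorphism. For an irreducible hypersurface $\mathcal X\subset\mathbb P^{n+1}$ of degree $d\ge3$ and a point $P\in\mathbb P^{n+1}$ (on $\mathcal X$ or not), $\pi_P\colon\mathcal X\dashrightarrow\mathbb P^n$ denotes the projection with center $P$. Let $m$ be the multiplicity of $\mathcal X$ at $P$ ($m=0$ if $P\notin\mathcal X$). The map $\pi_P$ is assumed dominant (i.e. $m<d$), so it induces a field extension $k(\mathbb P^n)\hookrightarrow k(\mathcal X)$ of degree $d-m$. The point $P$ is a Galois point for $\mathcal X$ if this extension is Galois; its Galois group is the Galois group of $\pi_P$. It is a wild Galois point if moreover $p$ divides $d-m$. Automorphisms of $k(\mathcal X)$ over $k$ are identified with birational self-maps of $\mathcal X$ via pullback. The Galois point $P$ is extendable if the Galois group is given by a subgroup of $\mathrm{PGL}(n+2,k)$, i.e. every element of it is the restriction to $\mathcal X$ of an element of $\mathrm{PGL}(n+2,k)$ preserving $\mathcal X$; the Galois group is then regarded as a subgroup of $\mathrm{PGL}(n+2,k)$, and ''$G$ is the Galois group'' means equality of subgroups of $\mathrm{PGL}(n+2,k)$. *)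

(* Defs.v *)
From HB Require Import structures.
From mathcomp Require Import all_boot all_order all_algebra.
From mathcomp Require Import all_fingroup all_solvable all_field.
From mathcomp Require Import generic_quotient ring_quotient fraction.
From mathcomp Require Import mpoly boolp zify.

Set Implicit Arguments.
Unset Strict Implicit.
Unset Printing Implicit Defensive.

Import GRing.Theory.
Local Open Scope ring_scope.
Local Open Scope quotient_scope.

Section Divisibility.
Variable R : idomainType.

Definition dvdr (x y : R) : Prop := exists q, y = q * x.

Definition irreducible_elt (x : R) : Prop :=
  [/\ x != 0, x \isn't a GRing.unit
    & forall a b, x = a * b -> a \is a GRing.unit \/ b \is a GRing.unit].

(* The ideal (x) is prime; x = 0 is allowed. *)
Definition prime_gen (x : R) : Prop :=
  x \isn't a GRing.unit /\
  forall a b, dvdr x (a * b) -> dvdr x a \/ dvdr x b.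

Lemma prime_gen0 : prime_gen 0.
Proof.
split=> [|a b [q /eqP]]; first by rewrite unitr0.
rewrite mulr0 mulf_eq0 => /orP[]/eqP->; [left|right]; exists 0; by rewrite mulr0.
Qed.

Definition pideal (x : R) of prime_gen x : pred R := fun a => `[< dvdr x a >].

Section Pideal.
Variables (x : R) (xP : prime_gen x).

Lemma pidealP a : reflect (dvdr x a) (a \in pideal xP).
Proof. exact: asboolP. Qed.

Lemma pideal_closed : idealr_closed (pideal xP).
Proof.
split=> [||a u v].
- by apply/pidealP; exists 0; rewrite mul0r.
- apply/pidealP => -[q e]; case: xP => /unitrP[]; exists q.
  by rewrite -e mulrC -e.
- move=> /pidealP[q ->] /pidealP[r ->]; apply/pidealP.
  by exists (a * q + r); rewrite mulrDl mulrA.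
Qed.

Lemma pideal_prime : prime_idealr_closed (pideal xP).
Proof.
move=> u v /pidealP/xP.2 h; apply/orP.
by case: h => h; [left|right]; apply/pidealP.
Qed.

HB.instance Definition _ := isIdealr.Build R (pideal xP) pideal_closed.
HB.instance Definition _ := isPrimeIdealrClosed.Build R (pideal xP) pideal_prime.

End Pideal.
End Divisibility.

(* R / I, with the integral domain structure that ring_quotient leaves out. *)
Section QuotientDomain.
Variables (R : comNzRingType) (I : prime_idealr R).

Definition quot_dom := {ideal_quot I}.
HB.instance Definition _ := GRing.ComNzRing.on quot_dom.

Definition quot_unit : pred quot_dom := fun x => `[< exists y, y * x = 1 >].
Definition quot_inv (x : quot_dom) : quot_dom :=
  if pselect (exists y, y * x = 1) is left h then sval (cid h) else x.

Lemma quot_mulVr : {in quot_unit, left_inverse 1 quot_inv *%R}.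
Proof.
move=> x /asboolP xU; rewrite /quot_inv; case: pselect => [h|/(_ xU)//].
exact: (svalP (cid h)).
Qed.

Lemma quot_unitP (x y : quot_dom) : y * x = 1 -> x \in quot_unit.
Proof. by move=> h; apply/asboolP; exists y. Qed.

Lemma quot_inv_out : {in [predC quot_unit], quot_inv =1 id}.
Proof.
move=> x xU; rewrite /quot_inv; case: pselect => // h.
by case/negP: xU; apply/asboolP.
Qed.

HB.instance Definition _ := GRing.ComNzRing_hasMulInverse.Build quot_dom
  quot_mulVr quot_unitP quot_inv_out.

Lemma quot_idomainP (x y : quot_dom) : x * y = 0 -> (x == 0) || (y == 0).
Proof. exact: Quotient.rquot_IdomainAxiom. Qed.

HB.instance Definition _ := GRing.ComUnitRing_isIntegral.Build quot_dom
  quot_idomainP.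

Definition quot_proj (x : R) : quot_dom := \pi_({ideal_quot I}) x.

Lemma quot_proj_zmod : zmod_morphism quot_proj.
Proof. by move=> x y; rewrite /quot_proj rmorphB. Qed.
Lemma quot_proj_monoid : monoid_morphism quot_proj.
Proof. by split=> [|x y]; rewrite /quot_proj ?rmorph1 ?rmorphM. Qed.
HB.instance Definition _ := GRing.isZmodMorphism.Build R quot_dom quot_proj
  quot_proj_zmod.
HB.instance Definition _ := GRing.isMonoidMorphism.Build R quot_dom quot_proj
  quot_proj_monoid.

Lemma quot_proj_eq0 x : (quot_proj x == 0) = (x \in I).
Proof.
by rewrite -[0](rmorph0 quot_proj) /quot_proj -Quotient.idealrBE subr0.
Qed.

End QuotientDomain.

(* Irreducible elements of k[x_1, ..., x_n] are prime (Gauss). *)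
Section Gauss.
Variable R : idomainType.

Inductive factored : R -> Prop :=
| factored_unit u : u \is a GRing.unit -> factored u
| factored_mul p c : irreducible_elt p -> factored c -> factored (p * c).

Lemma factoredM a b : factored a -> factored b -> factored (a * b).
Proof.
move=> + fb; elim=> [u uU|p c pI _ IH]; last first.
  by rewrite -mulrA; apply: factored_mul.
case: fb => [v vU|p c [p0 pN pI] fc].
  by apply: factored_unit; rewrite unitrM uU.
rewrite mulrA; apply: factored_mul fc; split.
- by rewrite mulf_neq0 //; apply: contraTneq uU => ->; rewrite unitr0.
- by rewrite unitrM uU.
move=> a' b' e; have := pI (u^-1 * a') b'.
rewrite -mulrA -e mulKr // => /(_ erefl).
by rewrite unitrM unitrV uU.
Qed.

Lemma irr_factored a : irreducible_elt a -> factored a.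
Proof.
move=> aI; rewrite -[a]mulr1; apply: factored_mul aI _.
by apply: factored_unit; rewrite unitr1.
Qed.

Lemma factored_neq0 a : factored a -> a != 0.
Proof.
elim=> [u|p c [p0 _ _] _ c0]; last by rewrite mulf_neq0.
by apply: contraTneq => ->; rewrite unitr0.
Qed.

Hypothesis irrP : forall p : R, irreducible_elt p -> prime_gen p.
Hypothesis facP : forall c : R, c != 0 -> factored c.

Lemma size_poly_unit (f : {poly R}) : f \is a GRing.unit -> size f = 1%N.
Proof. by rewrite poly_unitE => /andP[/eqP]. Qed.

Lemma dvdr_polyC (p : R) (f : {poly R}) :
  dvdr p%:P f <-> forall i, dvdr p f`_i.
Proof.
split=> [[q ->] i|h]; first by exists q`_i; rewrite coefMC.
exists (\poly_(i < size f) sval (cid (h i))); apply/polyP => i.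
rewrite coefMC coef_poly; case: ltnP => [_|hi]; last first.
  by rewrite mul0r nth_default.
exact: (svalP (cid (h i))).
Qed.

Lemma dvdr_polyCM (p : R) (f g : {poly R}) : prime_gen p ->
  dvdr p%:P (f * g) -> dvdr p%:P f \/ dvdr p%:P g.
Proof.
move=> pP; pose pi := quot_proj (pideal pP : prime_idealr R).
have piP h : dvdr p%:P h <-> map_poly pi h = 0.
  rewrite dvdr_polyC; split=> [hh|hh i].
    apply/polyP => i; rewrite coef_map coef0; apply/eqP.
    by rewrite quot_proj_eq0; apply/pidealP.
  apply/(pidealP pP); rewrite -(quot_proj_eq0 (pideal pP : prime_idealr R)).
  by have /polyP/(_ i) := hh; rewrite coef_map coef0 => /eqP.
rewrite !piP rmorphM => /eqP; rewrite mulf_eq0.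
by case/orP => /eqP; [left|right].
Qed.

Lemma factored_split (c : R) (g d e : {poly R}) : factored c ->
  c%:P * g = d * e -> exists d' e' : {poly R}, exists a b : R,
  [/\ a != 0, b != 0, d = a%:P * d', e = b%:P * e' & g = d' * e'].
Proof.
move=> fc; elim: fc d e => [u uU|p {}c pI fc IH] d e.
  move=> h; exists d, (u^-1%:P * e), 1, u; split; first exact: oner_neq0.
  - by apply: contraTneq uU => ->; rewrite unitr0.
  - by rewrite mul1r.
  - by rewrite mulrA -polyCM mulrV // mul1r.
  - by rewrite mulrCA -h mulrA -polyCM mulVr // mul1r.
have p0 : p%:P != 0 :> {poly R} by rewrite polyC_eq0; case: pI.
rewrite polyCM -mulrA => h.
have [[q dq]|[q eq]] : dvdr p%:P d \/ dvdr p%:P e.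
- by apply: dvdr_polyCM (irrP pI) _; exists (c%:P * g); rewrite -h mulrC.
- have {}/IH : c%:P * g = q * e.
    by apply: (mulfI p0); rewrite h dq [RHS]mulrCA mulrA.
  case=> d' [e' [a [b [a0 b0 eq ee eg]]]].
  exists d', e', (p * a), b; split=> //.
    by rewrite mulf_neq0 // -polyC_eq0.
  by rewrite polyCM dq eq mulrC mulrA.
- have {}/IH : c%:P * g = d * q.
    by apply: (mulfI p0); rewrite h eq mulrA mulrC.
  case=> d' [e' [a [b [a0 b0 ed ee eg]]]].
  exists d', e', a, (p * b); split=> //.
    by rewrite mulf_neq0 // -polyC_eq0.
  by rewrite polyCM eq ee mulrC mulrA.
Qed.

Lemma irr_cancel (c : R) (f h E : {poly R}) : c != 0 ->
  irreducible_elt f -> (1 < size f)%N -> c%:P * h = E * f -> dvdr f h.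
Proof.
move=> /facP fc [f0 _ fI] sf /(factored_split fc).
case=> E' [f' [a [b [a0 b0 eE ef ->]]]].
have [|f'U] := fI _ _ ef.
  move=> bU; exists (E' * b%:P^-1); rewrite -mulrA; congr (_ * _).
  by rewrite ef mulKr.
by move: sf; rewrite ef mul_polyC size_scale // size_poly_unit.
Qed.

Lemma gauss (f : {poly R}) : irreducible_elt f -> prime_gen f.
Proof.
move=> fI; have [f0 fU fM] := fI; split=> // g h [q gh].
have [|sf] := leqP (size f) 1.
  move=> /size1_polyC; set c := f`_0 => fE; rewrite fE.
  have /irrP cP : irreducible_elt c.
    split; first by rewrite -polyC_eq0 -fE.
      by move: fU; rewrite fE poly_unitE size_polyC coefC /= -polyC_eq0 -fE f0.
    move=> a b cab; case: (fM a%:P b%:P); first by rewrite -polyCM -cab.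
      by rewrite poly_unitE coefC => /andP[]; left.
    by rewrite poly_unitE coefC => /andP[]; right.
  by apply: dvdr_polyCM cP _; exists q; rewrite -fE.
have [cop|ncop] := boolP (coprimep f g).
  right; have /Bezout_coprimepP[[u v] /= /eqpP[[c1 c2] /= /andP[c10 c20] e]] := cop.
  apply: (@irr_cancel c2 f h (c1%:P * (u * h + v * q))) => //.
  have -> : c2%:P = c1%:P * (u * f + v * g).
    by rewrite mul_polyC e -mul_polyC mulr1.
  rewrite -!mulrA; congr (_ * _); rewrite !mulrDl -!mulrA gh.
  by rewrite [f * h]mulrC.
left; move: ncop; rewrite coprimep_def => sd.
have /Pdiv.Idomain.dvdpP[[c e] /= c0 ef] := dvdp_gcdl f g.
have /Pdiv.Idomain.dvdpP[[c' e'] /= c'0 eg] := dvdp_gcdr f g.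
move: sd ef eg; set d := gcdp f g => sd ef eg.
have d0 : d != 0.
  apply: contraNneq f0 => dE; move: ef; rewrite dE mulr0 => /eqP.
  by rewrite -mul_polyC mulf_eq0 polyC_eq0 (negPf c0).
rewrite -mul_polyC in ef.
have [q1 [d1 [a [b [a0 b0 _ ed ef']]]]] := factored_split (facP c0) ef.
have [q1U|d1U] := fM _ _ ef'; last first.
  move: sd; rewrite ed mul_polyC size_scale //.
  by rewrite size_poly_unit.
apply: (@irr_cancel c' f g (e' * b%:P * q1^-1)) => //.
rewrite mul_polyC eg ed ef' -!mulrA; congr (_ * (_ * _)).
by rewrite mulKr.
Qed.

End Gauss.

Section GaussMpoly.
Variable k : fieldType.

Definition mpoly_of_uni n (p : {poly {mpoly k[n]}}) : {mpoly k[n.+1]} :=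
  (map_poly (@mwiden n k) p).['X_ord_max].


Lemma mpoly_of_uni_zmod n : zmod_morphism (@mpoly_of_uni n).
Proof. by move=> p q; rewrite /mpoly_of_uni !rmorphB /= hornerD hornerN. Qed.
Lemma mpoly_of_uni_monoid n : monoid_morphism (@mpoly_of_uni n).
Proof.
by split=> [|p q]; rewrite /mpoly_of_uni ?rmorph1 ?hornerC // rmorphM hornerM.
Qed.
HB.instance Definition _ n := GRing.isZmodMorphism.Build _ _ (@mpoly_of_uni n)
  (@mpoly_of_uni_zmod n).
HB.instance Definition _ n := GRing.isMonoidMorphism.Build _ _ (@mpoly_of_uni n)
  (@mpoly_of_uni_monoid n).

Lemma mpoly_of_uniC n a : @mpoly_of_uni n a%:P = mwiden a.
Proof. by rewrite /mpoly_of_uni map_polyC hornerC. Qed.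
Lemma mpoly_of_uniX n : @mpoly_of_uni n 'X = 'X_ord_max.
Proof. by rewrite /mpoly_of_uni map_polyX hornerX. Qed.

Lemma muniK n : cancel (@muni n k) (@mpoly_of_uni n).
Proof.
move=> p; rewrite muniE raddf_sum /= [RHS]mpolyE; apply: eq_bigr => m _.
rewrite -mul_polyC rmorphM rmorphXn /= mpoly_of_uniC mpoly_of_uniX.
rewrite mwidenZ mwidenX mpolyXn -scalerAl -mpolyXD; congr (_ *: 'X_[_]).
apply/mnmP => i; rewrite mnmDE mulmnE mnm1E.
have [->|ni] := eqVneq i ord_max; first by rewrite mnmwiden_ordmax mul1n.
have hi : (i < n)%N by rewrite ltn_neqAle ni -ltnS ltn_ord.
have -> : i = widen_ord (leqnSn n) (Ordinal hi) by apply: val_inj.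
by rewrite mnmwiden_widen mnmE addn0.
Qed.

Lemma mpoly_of_uniK n : cancel (@mpoly_of_uni n) (@muni n k).
Proof.
have wid a : muni (mwiden a) = a%:P :> {poly {mpoly k[n]}}.
  rewrite [a]mpolyE (raddf_sum (@mwiden n k)) (raddf_sum (@muni n k)) raddf_sum /=; apply: eq_bigr => m _.
  rewrite mwidenZ muniZ mwidenX muniE msuppX big_seq1 mcoeffX eqxx scale1r.
  rewrite mnmwiden_ordmax expr0 alg_polyC -mul_polyC -polyCM mul_mpolyC;
  congr ((_ *: 'X_[_])%:P).
  by apply/mnmP => i; rewrite mnmE mnmwiden_widen.
have X : muni 'X_ord_max = 'X :> {poly {mpoly k[n]}}.
  rewrite muniE msuppX big_seq1 mcoeffX eqxx scale1r mnm1E eqxx expr1.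
  have -> : [multinom U_(ord_max)%MM (widen_ord (leqnSn n) i) | i < n] = 0%MM.
    apply/mnmP => i; rewrite mnmE mnm1E mnm0E eqE /= eq_sym ltn_eqF //.
  by rewrite mpolyX0 scale1r.
move=> p; rewrite -[p in RHS]coefK poly_def /mpoly_of_uni horner_coef.
rewrite size_map_inj_poly ?mwiden0 //; last exact: inj_mwiden.
rewrite raddf_sum /=; apply: eq_bigr => i _.
by rewrite coef_map /= rmorphM rmorphXn /= wid X mul_polyC.
Qed.

Lemma unit_of_can (R S : unitRingType) (f : {rmorphism R -> S})
  (g : {rmorphism S -> R}) (x : R) : cancel f g ->
  (f x \is a GRing.unit) = (x \is a GRing.unit).
Proof.
by move=> fK; apply/idP/idP => /(rmorph_unit _) //; move=> /(_ _ g); rewrite fK.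
Qed.

Lemma dvdr_of_can (R S : idomainType) (f : {rmorphism R -> S})
  (g : {rmorphism S -> R}) (x y : R) : cancel f g ->
  dvdr (f x) (f y) <-> dvdr x y.
Proof.
move=> fK; split=> -[q h]; last by exists (f q); rewrite h rmorphM.
by exists (g q); rewrite -[y]fK h rmorphM fK.
Qed.

Lemma mpoly_factored n (p : {mpoly k[n]}) : p != 0 -> factored p.
Proof.
have [m] := ubnP (msize p); elim: m p => // m IH p sp p0.
have [pU|pU] := boolP (p \is a GRing.unit); first exact: factored_unit.
have [pI|pI] := pselect (irreducible_elt p); first exact: irr_factored.
have [[a [b [e aU bU]]]|no] := pselect (exists a b, [/\ p = a * b,
    a \isn't a GRing.unit & b \isn't a GRing.unit]); last first.
  exfalso; apply: pI; split=> // a b e.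
  have [|aU] := boolP (a \is a GRing.unit); first by left.
  have [|bU] := boolP (b \is a GRing.unit); first by right.
  by case: no; exists a, b.
have [a0 b0] : a != 0 /\ b != 0.
  by apply/andP; rewrite -negb_or -mulf_eq0 -e.
have big (c : {mpoly k[n]}) : c != 0 -> c \isn't a GRing.unit -> (1 < msize c)%N.
  move=> c0; apply: contraNltn => /msize1_polyC cE.
  by move: c0; rewrite cE mpolyC_eq0 => x0; rewrite rmorph_unit // unitfE.
have := msizeM a0 b0; rewrite -e => se.
have := big _ a0 aU; have := big _ b0 bU => sb sa.
rewrite e; apply: factoredM; apply: IH => //.
  by move: sp; rewrite se; move: sa sb; case: (msize a) (msize b) => [|x] [|y]; lia.
by move: sp; rewrite se; move: sa sb; case: (msize a) (msize b) => [|x] [|y]; lia.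
Qed.

Lemma irr_prime n (p : {mpoly k[n]}) : irreducible_elt p -> prime_gen p.
Proof.
elim: n p => [|n IH] p pI.
  have [p0 + _] := pI; move: p0; rewrite [p]nvar0_mpolyC mpolyC_eq0 => x0.
  by case/negP; rewrite rmorph_unit // unitfE.
have [p0 pU pM] := pI.
have qI : irreducible_elt (muni p).
  split.
  - by apply: contraNneq p0 => /(congr1 (@mpoly_of_uni n)); rewrite muniK raddf0 => ->.
  - by rewrite (unit_of_can _ (@muniK n)).
  - move=> a b /(congr1 (@mpoly_of_uni n)); rewrite muniK rmorphM => /pM.
    by rewrite !(unit_of_can _ (@mpoly_of_uniK n)).
have [_ qP] := gauss IH (@mpoly_factored n) qI.
split=> // a b; rewrite -!(dvdr_of_can _ _ (@muniK n)) rmorphM; exact: qP.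
Qed.
End GaussMpoly.

Section LinearGroups.
Variables (k : fieldType) (r : nat).

Record GL := mkGL { glmx :> 'M[k]_r; _ : glmx \in unitmx }.
HB.instance Definition _ := [isSub for glmx].
HB.instance Definition _ := [Choice of GL by <:].

Lemma GL_unit (A : GL) : (A : 'M[k]_r) \in unitmx. Proof. exact: valP. Qed.

Fact GL_one_subproof : (1%:M : 'M[k]_r) \in unitmx. Proof. exact: unitmx1. Qed.
Fact GL_mul_subproof (A B : GL) : (A : 'M[k]_r) *m B \in unitmx.
Proof. by rewrite unitmx_mul !GL_unit. Qed.
Fact GL_inv_subproof (A : GL) : invmx (A : 'M[k]_r) \in unitmx.
Proof. by rewrite unitmx_inv GL_unit. Qed.

Definition GL_one := mkGL GL_one_subproof.
Definition GL_mul A B := mkGL (GL_mul_subproof A B).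
Definition GL_inv A := mkGL (GL_inv_subproof A).

Lemma GL_mulA : associative GL_mul.
Proof. by move=> A B C; apply: val_inj; rewrite /= mulmxA. Qed.
Lemma GL_mul1g : left_id GL_one GL_mul.
Proof. by move=> A; apply: val_inj; rewrite /= mul1mx. Qed.
Lemma GL_mulg1 : right_id GL_one GL_mul.
Proof. by move=> A; apply: val_inj; rewrite /= mulmx1. Qed.
Lemma GL_mulVg : left_inverse GL_one GL_inv GL_mul.
Proof. by move=> A; apply: val_inj; rewrite /= mulVmx // GL_unit. Qed.
Lemma GL_mulgV : right_inverse GL_one GL_inv GL_mul.
Proof. by move=> A; apply: val_inj; rewrite /= mulmxV // GL_unit. Qed.
HB.instance Definition _ :=
  isGroup.Build GL GL_mulA GL_mul1g GL_mulg1 GL_mulVg GL_mulgV.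

Definition scalar_equiv (A B : GL) : bool :=
  `[< exists2 c : k, c != 0 & (A : 'M[k]_r) = c *: (B : 'M[k]_r) >].

Lemma scalar_equivP : equiv_class_of scalar_equiv.
Proof.
have sym A B : scalar_equiv A B -> scalar_equiv B A.
  move=> /asboolP[c c0 e]; apply/asboolP; exists c^-1; first by rewrite invr_eq0.
  by rewrite e scalerA mulVf // scale1r.
split=> [A|A B|B A C].
- by apply/asboolP; exists 1; rewrite ?oner_neq0 ?scale1r.
- by apply/idP/idP; apply: sym.
- move=> /asboolP[c c0 e1] /asboolP[d d0 e2]; apply/asboolP; exists (c * d).
    by rewrite mulf_neq0.
  by rewrite e1 e2 scalerA.
Qed.

Canonical scalar_equiv_rel := EquivRelPack scalar_equivP.
Canonical scalar_encModRel := defaultEncModRel scalar_equiv.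

Definition PGL := {eq_quot scalar_equiv}.
HB.instance Definition _ := EqQuotient.on PGL.
HB.instance Definition _ := Choice.on PGL.

Definition pr (A : GL) : PGL := \pi_PGL A.

Lemma prP (A B : GL) : pr A = pr B <->
  exists2 c : k, c != 0 & (A : 'M[k]_r) = c *: (B : 'M[k]_r).
Proof. by split=> [/eqmodP/asboolP|h]; last exact/eqmodP/asboolP. Qed.

Definition PGL_one : PGL := pr GL_one.
Definition PGL_mul (x y : PGL) : PGL := pr (GL_mul (repr x) (repr y)).
Definition PGL_inv (x : PGL) : PGL := pr (GL_inv (repr x)).

Lemma pr_repr (x : PGL) : pr (repr x) = x. Proof. exact: reprK. Qed.

Lemma prM (A B : GL) : pr (GL_mul A B) = PGL_mul (pr A) (pr B).
Proof.
have [c c0 eA] := (prP A (repr (pr A))).1 (esym (pr_repr _)).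
have [d d0 eB] := (prP B (repr (pr B))).1 (esym (pr_repr _)).
apply/prP; exists (c * d); first by rewrite mulf_neq0.
by rewrite /= {1}eA {1}eB -scalemxAl -scalemxAr scalerA.
Qed.

Lemma prV (A : GL) : pr (GL_inv A) = PGL_inv (pr A).
Proof.
have [c c0 eA] := (prP A (repr (pr A))).1 (esym (pr_repr _)).
apply/prP; exists c^-1; first by rewrite invr_eq0.
by rewrite /= {1}eA invmxZ // -?eA ?GL_unit.
Qed.

Lemma PGL_mulA : associative PGL_mul.
Proof.
move=> x y z; rewrite -[x]pr_repr -[y]pr_repr -[z]pr_repr.
by rewrite -!prM GL_mulA.
Qed.
Lemma PGL_mul1g : left_id PGL_one PGL_mul.
Proof. by move=> x; rewrite -[x]pr_repr -!prM GL_mul1g. Qed.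
Lemma PGL_mulg1 : right_id PGL_one PGL_mul.
Proof. by move=> x; rewrite -[x]pr_repr -!prM GL_mulg1. Qed.
Lemma PGL_mulVg : left_inverse PGL_one PGL_inv PGL_mul.
Proof. by move=> x; rewrite -[x]pr_repr -prV -!prM GL_mulVg. Qed.
Lemma PGL_mulgV : right_inverse PGL_one PGL_inv PGL_mul.
Proof. by move=> x; rewrite -[x]pr_repr -prV -!prM GL_mulgV. Qed.
HB.instance Definition _ :=
  isGroup.Build PGL PGL_mulA PGL_mul1g PGL_mulg1 PGL_mulVg PGL_mulgV.

Lemma pr_morph : {morph pr : A B / (A * B)%g >-> (A * B)%g}.
Proof. exact: prM. Qed.

(* pr restricts to a bijection, hence an isomorphism, from G' onto G. *)
Definition pr_isom (G' : {pred GL}) (G : {pred PGL}) : Prop :=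
  {in G' &, injective pr} /\
  forall g, g \in G <-> exists2 A, A \in G' & pr A = g.

Definition liftable (G : {pred PGL}) : Prop :=
  exists2 G' : {pred GL}, group_closed G' & pr_isom G' G.

End LinearGroups.

(* G is isomorphic to a semidirect product (Z/p)^u ><| Z/l. *)
Definition iso_elementary_sdprod (p u l : nat) (T : groupType) (G : {pred T}) :
  Prop :=
  exists (gT : finGroupType) (S K H : {group gT}) (phi : gT -> T),
  [/\ (K ><| H)%g = S, K \isog [set: 'rV['Z_p]_u], H \isog Zp l,
      {in S &, {morph phi : x y / (x * y)%g}} /\ {in S &, injective phi}
    & forall g, g \in G <-> exists2 s, s \in S & phi s = g].

(* Equality of the images of x |-> A x and x |-> B x on column vectors; (_ :=: _)
   compares row spaces, hence the transposes. *)
Definition same_image (k : fieldType) (r : nat) (A B : 'M[k]_r) : Prop :=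
  (A^T :=: B^T)%MS.

(* The function field of the projective variety with homogeneous prime ideal I:
   fractions a / b of homogeneous elements of equal degree, b not in I. *)
Section FunctionField.
Variables (k : fieldType) (m : nat) (I : prime_idealr {mpoly k[m]}).

Definition coord_ring := quot_dom I.

Definition form_ratio (a b : {mpoly k[m]}) : {fraction coord_ring} :=
  tofrac (quot_proj I a) / tofrac (quot_proj I b).

Definition degree0 : pred {fraction coord_ring} := fun z =>
  `[< exists d a b, [/\ a \is d.-homog, b \is d.-homog, b \notin I
                      & z = form_ratio a b] >].

Lemma quot_proj_neq0 b : b \notin I -> tofrac (quot_proj I b) != 0.
Proof. by move=> bI; rewrite tofrac_eq0 quot_proj_eq0. Qed.

Lemma degree0_closed : divring_closed degree0.
Proof.
split=> [|x y|x y].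
- apply/asboolP; exists 0, 1, 1; rewrite !dhomog1 idealr1.
  by split=> //; rewrite /form_ratio !rmorph1 divr1.
- move=> /asboolP[d [a [b [ha hb bI ->]]]] /asboolP[e [a' [b' [ha' hb' b'I ->]]]].
  apply/asboolP; exists (d + e)%N, (a * b' - a' * b), (b * b'); split.
  + by apply: rpredB; last (rewrite addnC); apply: dhomogM.
  + exact: dhomogM.
  + by rewrite prime_idealrM negb_or bI.
  + by rewrite /form_ratio -mulNr addf_div ?quot_proj_neq0 // !(rmorphM, rmorphB) mulNr.
- move=> /asboolP[d [a [b [ha hb bI ->]]]] /asboolP[e [a' [b' [ha' hb' b'I ->]]]].
  apply/asboolP; have [a'I|a'I] := boolP (a' \in I).
    exists 0, 0, 1; rewrite dhomog0 dhomog1 idealr1; split=> //.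
    have /eqP a'0 : quot_proj I a' == 0 by rewrite quot_proj_eq0.
    by rewrite /form_ratio a'0 !rmorph0 !mul0r invr0 mulr0.
  exists (d + e)%N, (a * b'), (b * a'); split; try exact: dhomogM.
    by rewrite prime_idealrM negb_or bI.
  by rewrite /form_ratio invf_div mulf_div !rmorphM.
Qed.

HB.instance Definition _ :=
  GRing.isDivringClosed.Build {fraction coord_ring} degree0 degree0_closed.

Record funfield := Funfield { ffval :> {fraction coord_ring}; _ : ffval \in degree0 }.
HB.instance Definition _ := [isSub for ffval].
HB.instance Definition _ := [Choice of funfield by <:].
HB.instance Definition _ := [SubChoice_isSubIntegralDomain of funfield by <:].

Lemma funfield_unit :
  {mono (val : funfield -> {fraction coord_ring}) : u / u \in GRing.unit}.
Proof.
move=> u; apply/idP/idP => [uU|]; last exact: rmorph_unit.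
have vU : (val u)^-1 \in degree0 by rewrite rpredV; exact: valP.
by apply/unitrP; exists (Funfield vU); split; apply: val_inj;
  rewrite rmorphM rmorph1 /= (mulVr, mulrV).
Qed.
HB.instance Definition _ :=
  GRing.SubIntegralDomain_isSubField.Build _ _ funfield funfield_unit.

End FunctionField.

Section Pullback.
Variable k : fieldType.

Definition mx_comp m n (A : 'M[k]_(m, n)) (F : {mpoly k[m]}) : {mpoly k[n]} :=
  F \mPo [tuple \sum_j A i j *: 'X_j | i < m].

(* phi is the pullback of rational functions along x |-> [A x], a rational map
   from the variety of J in P^(n-1), to the variety of I in P^(m-1). *)
Definition is_pullback m n (I : prime_idealr {mpoly k[m]})
    (J : prime_idealr {mpoly k[n]}) (A : 'M[k]_(m, n))
    (phi : funfield I -> funfield J) : Prop :=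
  forall d a b, a \is d.-homog -> b \is d.-homog -> b \notin I ->
  mx_comp A b \notin J /\
  forall z : funfield I, ffval z = form_ratio I a b ->
    ffval (phi z) = form_ratio J (mx_comp A a) (mx_comp A b).

End Pullback.

(* K -> L is isomorphic, over K, to a Galois extension in the sense of galois.v. *)
Definition is_galois (K L : fieldType) (iota : {rmorphism K -> L}) : Prop :=
  exists (E : splittingFieldType K) (f : {rmorphism E -> L}),
  [/\ bijective f, forall a, f a%:A = iota a & galois 1 {:E}].

Definition galois_aut (K L : fieldType) (iota : {rmorphism K -> L})
    (s : {rmorphism L -> L}) : Prop :=
  bijective s /\ forall a, s (iota a) = iota a.

(* An irreducible hypersurface of P^n is given by an irreducible form in n + 1
   variables. *)
Record hypersurface (k : fieldType) (n : nat) := Hypersurface {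
  heqn : {mpoly k[n.+1]};
  heqn_homog : heqn \is homog mdeg;
  heqn_irr : irreducible_elt heqn }.

(* Points of P^(n+1) are represented by nonzero column vectors of size n + 2. *)
Section GaloisPoints.
Variables (k : fieldType) (n : nat).
Implicit Types (X : hypersurface k n.+1) (P : 'cV[k]_n.+2).

Definition hdeg X : nat := (msize (heqn X)).-1.

(* The least degree of a monomial of heqn X (P + x), x = (x_0, ..., x_(n+1)). *)
Definition hmult X P : nat :=
  let F := heqn X \mPo [tuple (P i 0)%:MP + 'X_i | i < n.+2] in
  \big[minn/msize F]_(m <- msupp F) mdeg m.

Definition hideal X : prime_idealr {mpoly k[n.+2]} :=
  pideal (irr_prime (heqn_irr X)).

Definition pspace_ideal : prime_idealr {mpoly k[n.+1]} :=
  pideal (prime_gen0 {mpoly k[n.+1]}).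

(* k(X) and k(P^n) *)
Definition kX X := funfield (hideal X).
Definition kP := funfield pspace_ideal.

(* iota is the pullback along the projection with center P, written
   x |-> [M x] with M a matrix whose kernel is the line spanned by P. *)
Definition projection_pullback X P (iota : kP -> kX X) : Prop :=
  exists2 M : 'M[k]_(n.+1, n.+2),
    \rank M = n.+1 /\ M *m P = 0 & is_pullback M iota.

Definition galois_point X P (iota : {rmorphism kP -> kX X}) : Prop :=
  [/\ P != 0, (hmult X P < hdeg X)%N, projection_pullback P iota
    & is_galois iota].

Definition preserves (A : 'M[k]_n.+2) X : Prop :=
  forall x : 'cV[k]_n.+2, (heqn X).@[fun i => x i 0] = 0 <->
                          (heqn X).@[fun i => (A *m x) i 0] = 0.

(* g preserves X, and s is the pullback along the restriction of g to X. *)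
Definition restricts_to X (g : PGL k n.+2) (s : kX X -> kX X) : Prop :=
  exists A : GL k n.+2, [/\ pr A = g, preserves A X & is_pullback A s].

Definition extendable X (iota : {rmorphism kP -> kX X}) : Prop :=
  forall s, galois_aut iota s -> exists g, restricts_to g s.

Definition is_galois_group X (iota : {rmorphism kP -> kX X})
    (G : {pred PGL k n.+2}) : Prop :=
  forall g, g \in G <-> exists2 s, galois_aut iota s & restricts_to g s.

End GaloisPoints.

(* Main.v *)
(* If G is the Galois group of the projection from P, written x |-> M x, then any
   lift A of g in G satisfies M A x ~ M x on X; since X has degree at least 3,
   no quadric contains it, so M A = c M, and A is normalised by c = 1. The image
   of A - 1 is then in ker M, the line spanned by P.

   Conversely let v span the common image, in coordinates where v is the last
   basis vector. All elements of G' fix the other coordinates y_0, ..., y_n and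
   send y_t to a y_t + w with w a linear form in y_0, ..., y_n. Take for X the
   hypersurface y_0 N + y_n^(|G'| + 1) = 0, where N is the product of the G'-orbit
   of y_t, and P = v, a simple point. The equation is irreducible by Eisenstein at
   y_0. Over k(P^n), the function z = y_t / y_0 generates k(X), is a root of a
   polynomial of degree |G'|, and has |G'| distinct images under G'.

   Liftability holds because an element of order p has exactly one lift of order
   dividing p, the p-th root of unity 1 being unique; commuting elements then have
   commuting lifts. A generator of the complement Z/l is lifted by extracting
   an l-th root. *)
From HB Require Import structures.
Require Import Defs.
From mathcomp Require Import all_boot all_order all_algebra.
From mathcomp Require Import all_fingroup all_solvable all_field.
From mathcomp Require Import generic_quotient ring_quotient fraction.
From mathcomp Require Import boolp mpoly zify.

Set Implicit Arguments.
Unset Strict Implicit.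
Unset Printing Implicit Defensive.

Import GRing.Theory.
Local Open Scope ring_scope.

(** * Liftability *)

Section LiftUniq.
Variables (k : fieldType) (r : nat).
Implicit Types (A B : GL k r) (g h : PGL k r).

Lemma prMg A B : pr (A * B)%g = (pr A * pr B)%g.
Proof. exact: prM. Qed.
Lemma prVg A : pr (A^-1)%g = ((pr A)^-1)%g.
Proof. exact: prV. Qed.
Lemma pr1g : pr (1%g : GL k r) = 1%g.
Proof. by []. Qed.
Lemma prXg A m : pr (A ^+ m)%g = (pr A ^+ m)%g.
Proof. by elim: m => [|m IH]; rewrite ?expg0 // !expgS prMg IH. Qed.

Lemma GLmxM A B : ((A * B)%g : 'M[k]_r) = (A : 'M[k]_r) *m (B : 'M[k]_r).
Proof. by []. Qed.
Lemma GLmx1 : ((1%g : GL k r) : 'M[k]_r) = 1%:M.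
Proof. by []. Qed.

Lemma glmx_scaleX (c : k) A B : (A : 'M[k]_r) = c *: (B : 'M[k]_r) ->
  forall m, ((A ^+ m)%g : 'M[k]_r) = c ^+ m *: ((B ^+ m)%g : 'M[k]_r).
Proof.
move=> e; elim=> [|m IH]; first by rewrite !expg0 expr0 scale1r.
by rewrite !expgS !GLmxM IH e exprS -scalemxAl -scalemxAr scalerA.
Qed.

End LiftUniq.

Section LiftPow.
Variables (k : fieldType) (r : nat) (p : nat) (pk : p \in [pchar k]).
Implicit Types (A B : GL k r.+1).

(** In characteristic p, (c - 1)^p = c^p - 1. *)
Lemma expr_pchar_eq1 (c : k) : c ^+ p = 1 -> c = 1.
Proof.
move=> e; apply/eqP; rewrite -subr_eq0; have := pFrobenius_autB_comm pk (commr1 c).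
rewrite !pFrobenius_autE e expr1n subrr => /eqP.
by rewrite expf_eq0 => /andP[].
Qed.

(** Two lifts differ by a scalar c, and taking p-th powers gives c^p = 1. *)
Lemma lift_uniq A B : pr A = pr B -> (A ^+ p)%g = 1%g -> (B ^+ p)%g = 1%g ->
  A = B.
Proof.
move=> /prP[c c0 e] Ap Bp; apply: val_inj; rewrite /= e.
have := glmx_scaleX e p; rewrite Ap Bp => /matrixP/(_ 0 0).
rewrite !mxE eqxx mulr1 => /esym/expr_pchar_eq1->; exact: scale1r.
Qed.

(** Both [A] and its conjugate [A ^ B] are lifts of [pr A] with p-th power 1, so [lift_uniq]
    identifies them. *)
Lemma lift_commute A B : (A ^+ p)%g = 1%g -> commute (pr A) (pr B) ->
  commute A B.
Proof.
move=> Ap cAB; rewrite /commute; have -> : (A * B = B * A ^ B)%g by rewrite conjgC.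
congr (_ * _)%g; apply/lift_uniq => //; last by rewrite -conjXg Ap conj1g.
by apply: (mulgI (pr B)); rewrite -prMg -conjgC prMg cAB.
Qed.

End LiftPow.

(** The m-th power of any lift is a scalar c; rescaling the lift by an m-th root of 1/c turns it
    into 1. *)
Lemma lift_expg_eq1 (k : closedFieldType) r (g : PGL k r) m : (0 < m)%N ->
  (g ^+ m)%g = 1%g -> exists2 A : GL k r, pr A = g & (A ^+ m)%g = 1%g.
Proof.
move=> m0; have [B <-] : exists B, pr B = g by eexists; exact: pr_repr.
rewrite -prXg -pr1g => /prP[c c0 e].
have [x /eqP] : exists x, root ('X^m - (c^-1)%:P) x.
  by apply/closed_rootP; rewrite size_XnsubC //; case: (m) m0.
rewrite !hornerE => /eqP; rewrite subr_eq0 => /eqP xm.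
have x0 : x != 0.
  apply/eqP => x00; move: xm; rewrite x00 expr0n (gtn_eqF m0) => /eqP.
  by rewrite eq_sym invr_eq0 (negPf c0).
have xU : x *: (B : 'M[k]_r) \in unitmx.
  by rewrite unitmxZ ?unitfE // Defs.GL_unit.
exists (mkGL xU); first by apply/prP; exists x.
apply: val_inj => /=; rewrite (@glmx_scaleX _ _ x _ B) // e scalerA xm.
by rewrite mulVf // scale1r.
Qed.

Section Liftable.
Variables (k : closedFieldType) (r p : nat) (pk : p \in [pchar k]).
Variables (u l : nat) (G : {pred PGL k r.+1}).

(** The lift consists of the products [A1 * b ^+ i], where [A1] is the p-torsion lift of an element
    of K and [b] is a lift of a generator of H of the same order. *)
Lemma liftable_sdprod : iso_elementary_sdprod p u l G -> liftable G.
Proof.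
case=> gT [S [K [H [phi [defS isoK isoH [phiM phiI] GP]]]]].
have pP : prime p by apply: pcharf_prime pk.
have /cyclicP[h0 defH] : cyclic H.
  rewrite (isog_cyclic isoH) /= /Zp; case: ifP => _; last exact: cyclic1.
  by rewrite Zp_cycle cycle_cyclic.
have [nKS sHS _ nKH _] := sdprod_context defS.
have sKS : K \subset S by apply: normal_sub.
have h0H : h0 \in H by rewrite defH cycle_id.
have h0S : h0 \in S by apply: (subsetP sHS).
have abK : abelian K by rewrite (isog_abelian isoK) FinRing.zmod_abelian.
have KX : {in K, forall x, (x ^+ p)%g = 1%g}.
  have : p.-abelem%g [set: 'rV['Z_p]_u].
    apply/abelemP => //; split=> [|y _]; first exact: FinRing.zmod_abelian.
    rewrite FinRing.zmodXgE; apply/rowP => j; rewrite mulmxnE mxE -mulr_natr.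
    by rewrite pchar_Zp ?mulr0 // prime_gt1.
  by rewrite -(isog_abelem isoK) => /(abelemP pP)[_ h] x; apply: h.
have phi1 : phi 1%g = 1%g by apply: (mulgI (phi 1%g)); rewrite -phiM // mulg1 mulg1.
have phiX x m : x \in S -> phi (x ^+ m)%g = (phi x ^+ m)%g.
  move=> xS; elim: m => [|m IH]; first by rewrite !expg0.
  by rewrite !expgS phiM ?groupX // IH.
have phiV x : x \in S -> phi (x^-1)%g = ((phi x)^-1)%g.
  by move=> xS; apply: (mulgI (phi x)); rewrite -phiM ?groupV // !mulgV.
have [b prb bX] : exists2 b : GL k r.+1, pr b = phi h0 & (b ^+ #[h0])%g = 1%g.
  by apply: lift_expg_eq1; rewrite ?order_gt0 // -phiX // expg_order.
have prbX i : pr (b ^+ i)%g = phi (h0 ^+ i)%g by rewrite prXg prb phiX.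
(* The p-torsion lifts of phi(K), exactly one for each element. They commute because K is abelian,
   so their products are again p-torsion. *)
pose K' (A : GL k r.+1) := (A ^+ p)%g = 1%g /\ exists2 x, x \in K & pr A = phi x.
have K'1 : K' 1%g by split; [rewrite expg1n | exists 1%g; rewrite // pr1g phi1].
have K'M A B : K' A -> K' B -> K' (A * B)%g.
  move=> [Ap [x xK ex]] [Bp [y yK ey]].
  have cKK : commute x y by apply: (centsP abK).
  have cAB : commute A B.
    apply: lift_commute Ap _ => //; rewrite /commute ex ey.
    by rewrite -!phiM ?(subsetP sKS) // cKK.
  split; first by rewrite expgMn // Ap Bp mulg1.
  by exists (x * y)%g; rewrite ?groupM // prMg ex ey -phiM // ?(subsetP sKS).
have K'V A : K' A -> K' (A^-1)%g.
  move=> [Ap [x xK ex]]; split; first by rewrite expVgn Ap invg1.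
  by exists (x^-1)%g; rewrite ?groupV // prVg ex phiV // (subsetP sKS).
have K'J A i : K' A -> K' (A ^ (b ^+ i))%g.
  move=> [Ap [x xK ex]]; split; first by rewrite -conjXg Ap conj1g.
  exists (x ^ (h0 ^+ i))%g; first by rewrite memJ_norm // (subsetP nKH) // groupX.
  rewrite /conjg !prMg prVg prbX ex.
  have ? : x \in S by apply: (subsetP sKS).
  by rewrite !phiM ?phiV // ?groupM ?groupV ?groupX.
(* Powers of [b] with natural exponents already form a group. *)
have bV i : exists j, (b ^- i)%g = (b ^+ j)%g.
  exists (i * #[h0]%g.-1)%N; apply: (mulgI (b ^+ i)%g); rewrite mulgV -expgD.
  rewrite -mulnS prednK ?order_gt0 // mulnC expgM bX expg1n //.
pose G' : {pred GL k r.+1} := fun A =>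
  `[< exists A1 i, K' A1 /\ A = (A1 * b ^+ i)%g >].
exists G'; last split.
- split=> [|A B /asboolP[A1 [i [KA ->]]] /asboolP[B1 [j [KB ->]]]].
    by apply/asboolP; exists 1%g, 0%N; rewrite expg0 mulg1.
  have [j' bj] := bV j; have [i' bi] := bV (i + j')%N.
  apply/asboolP; exists (A1 * B1^-1 ^ (b ^+ i'))%g, (i + j')%N; split.
    by apply: K'M => //; apply/K'J/K'V.
  by rewrite -bi /conjg invgK invMg bj -!mulgA mulVg mulg1 expgD !mulgA.
- move=> A B /asboolP[A1 [i [KA ->]]] /asboolP[B1 [j [KB ->]]].
  have [Ap [x xK ex]] := KA; have [Bp [y yK ey]] := KB.
  have [xS yS] : x \in S /\ y \in S by split; apply: (subsetP sKS).
  have hS m : (h0 ^+ m)%g \in S by apply: groupX.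
  rewrite !prMg !prbX ex ey -(phiM _ _ xS (hS i)) -(phiM _ _ yS (hS j)).
  move=> /phiI => /(_ (groupM xS (hS i)) (groupM yS (hS j))) e.
  (* Factorisation along K and H is unique in S, so both factors can be compared separately. *)
  have [exy eij] : x = y /\ (h0 ^+ i = h0 ^+ j)%g.
    have xyS := groupM xS (hS i).
    have [x' [y' [_ _ _ U]]] := mem_sdprod defS xyS.
    have [-> ->] := U _ _ xK (groupX i h0H) erefl.
    by have [-> ->] := U _ _ yK (groupX j h0H) e.
  congr (_ * _)%g; first by apply: (lift_uniq pk) => //; rewrite ex ey exy.
  move/eqP: eij; rewrite eq_expg_mod_order => /eqP eij.
  (* The power of [b] depends only on the exponent modulo the order of [h0], so equal powers of [h0]
     have equal lifts. *)
  have bm m : (b ^+ (m %% #[h0]%g) = b ^+ m)%g.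
    by rewrite [in RHS](divn_eq m #[h0]%g) expgD mulnC expgM bX expg1n mul1g.
  by rewrite -bm eij bm.
move=> g; rewrite GP; split=> [[s sS <-]|[A /asboolP[A1 [i [[Ap [x xK ex]] ->]]] <-]].
  have [x [y [xK yH -> _]]] := mem_sdprod defS sS.
  move: yH; rewrite defH => /cycleP[i ->].
  have [A prA Ap] : exists2 A : GL k r.+1, pr A = phi x & (A ^+ p)%g = 1%g.
    apply: lift_expg_eq1; first exact: prime_gt0.
    by rewrite -phiX ?KX // (subsetP sKS).
  have xS : x \in S by apply: (subsetP sKS).
  have hS : (h0 ^+ i)%g \in S by apply: groupX.
  exists (A * b ^+ i)%g; last by rewrite prMg prA prbX phiM.
  by apply/asboolP; exists A, i; do !split=> //; exists x.
have xS : x \in S by apply: (subsetP sKS).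
have hS : (h0 ^+ i)%g \in S by apply: groupX.
exists (x * h0 ^+ i)%g; first exact: groupM.
by rewrite prMg ex prbX phiM.
Qed.
End Liftable.

(** * Pullbacks of rational functions *)

Lemma mpoly_rmorph_ext (R : comNzRingType) m (S : comNzRingType)
    (f g : {rmorphism {mpoly R[m]} -> S}) :
  (forall c, f c%:MP = g c%:MP) -> (forall i, f 'X_i = g 'X_i) -> f =1 g.
Proof.
move=> fgC fgX q; rewrite [q]mpolyE !rmorph_sum; apply: eq_bigr => e _.
rewrite -mul_mpolyC !rmorphM fgC /= mpolyXE_id !rmorph_prod; congr (_ * _).
by apply: eq_bigr => i _; rewrite !rmorphXn fgX.
Qed.

Section MxComp.
Variable k : fieldType.

HB.instance Definition _ m n (A : 'M[k]_(m, n)) :=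
  GRing.RMorphism.copy (mx_comp A) (comp_mpoly [tuple \sum_j A i j *: 'X_j | i < m]).

Lemma mx_compX m n (A : 'M[k]_(m, n)) i : mx_comp A 'X_i = \sum_j A i j *: 'X_j.
Proof. by rewrite /mx_comp comp_mpolyXU -tnth_nth tnth_mktuple. Qed.

Lemma mx_compC m n (A : 'M[k]_(m, n)) c : mx_comp A c%:MP = c%:MP.
Proof. exact: comp_mpolyC. Qed.

Lemma mx_compZ m n (A : 'M[k]_(m, n)) c q : mx_comp A (c *: q) = c *: mx_comp A q.
Proof. exact: comp_mpolyZ. Qed.

Lemma mx_comp_mul m n r (A : 'M[k]_(m, n)) (B : 'M[k]_(n, r)) q :
  mx_comp (A *m B) q = mx_comp B (mx_comp A q).
Proof.
move: q; apply: (@mpoly_rmorph_ext _ _ _ (mx_comp (A *m B)) (mx_comp B \o mx_comp A)).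
  by move=> c /=; rewrite !mx_compC.
move=> i; rewrite /= !mx_compX rmorph_sum /=.
under [RHS]eq_bigr => j _ do rewrite mx_compZ mx_compX scaler_sumr.
rewrite exchange_big /=; apply: eq_bigr => j _.
by rewrite mxE scaler_suml; apply: eq_bigr => h _; rewrite scalerA.
Qed.

Lemma mx_comp1 m q : mx_comp (1%:M : 'M[k]_m) q = q.
Proof.
move: q; apply: (@mpoly_rmorph_ext _ _ _ (mx_comp 1%:M) idfun).
  by move=> c /=; rewrite mx_compC.
move=> i; rewrite /= mx_compX (bigD1 i) //= mxE eqxx scale1r big1 ?addr0 // => j ji.
by rewrite mxE eq_sym (negPf ji) scale0r.
Qed.

Lemma mx_comp_homog m n (A : 'M[k]_(m, n)) d q :
  q \is d.-homog -> mx_comp A q \is d.-homog.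
Proof.
move=> /dhomogP hq; rewrite [q]mpolyE rmorph_sum big_seq; apply: rpred_sum => /= e he.
rewrite mx_compZ; apply: dhomogZ; rewrite -(hq e he) mpolyXE_id rmorph_prod /=.
rewrite mdegE.
elim/big_ind2: _ => [|x1 d1 x2 d2 h1 h2|i _]; first exact: dhomog1.
  exact: dhomogM.
rewrite rmorphXn /= -[X in X.-homog]mul1n; apply: dhomogMn; rewrite mx_compX.
by apply: rpred_sum => j _; apply: dhomogZ; rewrite dhomogX /= mdeg1.
Qed.

Lemma meval_mx_comp m n (A : 'M[k]_(m, n)) q (x : 'I_n -> k) :
  (mx_comp A q).@[x] = q.@[fun i => \sum_j A i j * x j].
Proof.
rewrite /mx_comp comp_mpoly_meval; apply: meval_eq => i.
rewrite tnth_mktuple raddf_sum; apply: eq_bigr => j _ /=.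
by rewrite mevalZ mevalXU.
Qed.

End MxComp.

Section FormRatio.
Variables (k : fieldType) (m : nat) (I : prime_idealr {mpoly k[m]}).
Implicit Types a b c : {mpoly k[m]}.

Lemma form_ratio_eq a b a' b' : b \notin I -> b' \notin I ->
  form_ratio I a b = form_ratio I a' b' <-> a * b' - a' * b \in I.
Proof.
move=> bI b'I; rewrite -quot_proj_eq0 -tofrac_eq0 !rmorphB !rmorphM /= subr_eq0.
by rewrite -eqr_div ?quot_proj_neq0 //; split=> /eqP.
Qed.

Lemma form_ratioD a b a' b' : b \notin I -> b' \notin I ->
  form_ratio I a b + form_ratio I a' b' = form_ratio I (a * b' + a' * b) (b * b').
Proof.
move=> bI b'I; rewrite /form_ratio addf_div ?quot_proj_neq0 //.
by rewrite !(rmorphM, rmorphD).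
Qed.

Lemma form_ratioN a b : - form_ratio I a b = form_ratio I (- a) b.
Proof. by rewrite /form_ratio !rmorphN mulNr. Qed.

Lemma form_ratioM a b a' b' :
  form_ratio I a b * form_ratio I a' b' = form_ratio I (a * a') (b * b').
Proof. by rewrite /form_ratio mulf_div !rmorphM. Qed.

Lemma form_ratio_degree0 d a b : a \is d.-homog -> b \is d.-homog -> b \notin I ->
  form_ratio I a b \in @degree0 k m I.
Proof. by move=> ha hb bI; apply/asboolP; exists d, a, b. Qed.

Lemma funfieldP (z : funfield I) : exists d a b,
  [/\ a \is d.-homog, b \is d.-homog, b \notin I & ffval z = form_ratio I a b].
Proof. exact/asboolP/(valP z). Qed.

Lemma form_ratio_ex d a b : a \is d.-homog -> b \is d.-homog -> b \notin I ->
  exists z : funfield I, ffval z = form_ratio I a b.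
Proof. by move=> ha hb bI; exists (Funfield (form_ratio_degree0 ha hb bI)). Qed.

End FormRatio.

Section PullbackTheory.
Variables (k : fieldType) (m n : nat).
Variables (I : prime_idealr {mpoly k[m]}) (J : prime_idealr {mpoly k[n]}).
Variable A : 'M[k]_(m, n).

(** [is_pullback] prescribes the value on every representing fraction, so a bare function satisfying
    it must respect the operations; the same holds for products below. *)
Lemma pullback_zmod (phi : funfield I -> funfield J) :
  is_pullback A phi -> zmod_morphism phi.
Proof.
move=> pb x y; have [d [a [b [ha hb bI ex]]]] := funfieldP x.
have [e [a' [b' [ha' hb' b'I ey]]]] := funfieldP y.
have [AbJ px] := pb _ _ _ ha hb bI; have [Ab'J py] := pb _ _ _ ha' hb' b'I.
have h1 : a * b' + (- a') * b \is (d + e).-homog.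
  apply: rpredD; first exact: dhomogM.
  by rewrite addnC; apply: dhomogM => //; rewrite rpredN.
have bbI : b * b' \notin I by rewrite prime_idealrM negb_or bI.
have [_ pxy] := pb _ _ _ h1 (dhomogM hb hb') bbI.
apply: val_inj; rewrite /= (pxy (x - y)); last first.
  by rewrite /= ex ey form_ratioN form_ratioD.
rewrite (px _ ex) (py _ ey) form_ratioN form_ratioD //.
by rewrite !(rmorphM, rmorphD, rmorphN).
Qed.

Lemma pullback_monoid (phi : funfield I -> funfield J) :
  is_pullback A phi -> monoid_morphism phi.
Proof.
move=> pb; split=> [|x y].
  have [_ p1] := pb _ _ _ (dhomog1 _ _) (dhomog1 _ _) (negbT (idealr1 I)).
  apply: val_inj; rewrite /= (p1 1); first by rewrite /form_ratio !rmorph1 divr1.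
  by rewrite /= /form_ratio !rmorph1 divr1.
have [d [a [b [ha hb bI ex]]]] := funfieldP x.
have [e [a' [b' [ha' hb' b'I ey]]]] := funfieldP y.
have [AbJ px] := pb _ _ _ ha hb bI; have [Ab'J py] := pb _ _ _ ha' hb' b'I.
have bbI : b * b' \notin I by rewrite prime_idealrM negb_or bI.
have [_ pxy] := pb _ _ _ (dhomogM ha ha') (dhomogM hb hb') bbI.
apply: val_inj; rewrite /= (pxy (x * y)); last by rewrite /= ex ey form_ratioM.
by rewrite (px _ ex) (py _ ey) form_ratioM !rmorphM.
Qed.

(** In the hypothesis, the implication from I to J makes the value independent of the chosen
    fraction, and the one from J to I keeps denominators nonzero. *)
Lemma pullback_ex :
  (forall d a, a \is d.-homog -> (mx_comp A a \in J) = (a \in I)) ->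
  exists phi : {rmorphism funfield I -> funfield J}, is_pullback A phi.
Proof.
move=> AIJ.
have ex (z : funfield I) : exists w : funfield J, forall d a b,
    a \is d.-homog -> b \is d.-homog -> b \notin I -> ffval z = form_ratio I a b ->
    ffval w = form_ratio J (mx_comp A a) (mx_comp A b).
  have [d [a [b [ha hb bI ez]]]] := funfieldP z.
  have [|w ew] := form_ratio_ex (I := J) (mx_comp_homog A ha) (mx_comp_homog A hb).
    by rewrite (AIJ d).
  exists w => e a' b' ha' hb' b'I; rewrite ez ew => /(form_ratio_eq _ _ bI b'I) h.
  apply/form_ratio_eq; rewrite ?(AIJ _ _ hb) ?(AIJ _ _ hb') //.
  rewrite -!rmorphM -rmorphB (AIJ (d + e)%N) //; apply: rpredB; first exact: dhomogM.
  by rewrite addnC; apply: dhomogM.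
pose phi z := sval (cid (ex z)).
have pb : is_pullback A phi.
  move=> d a b ha hb bI; split; first by rewrite (AIJ d).
  by move=> z; exact: (svalP (cid (ex z)) d a b ha hb bI).
pose phiM : {rmorphism funfield I -> funfield J} := HB.pack phi
  (GRing.isZmodMorphism.Build _ _ phi (pullback_zmod pb))
  (GRing.isMonoidMorphism.Build _ _ phi (pullback_monoid pb)).
by exists phiM.
Qed.

End PullbackTheory.

Lemma pullback_comp (k : fieldType) m n r (I : prime_idealr {mpoly k[m]})
    (J : prime_idealr {mpoly k[n]}) (K : prime_idealr {mpoly k[r]})
    (A : 'M[k]_(m, n)) (B : 'M[k]_(n, r)) (phi : funfield I -> funfield J)
    (psi : funfield J -> funfield K) :
  is_pullback A phi -> is_pullback B psi -> is_pullback (A *m B) (psi \o phi).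
Proof.
move=> pA pB d a b ha hb bI; have [AbJ pa] := pA _ _ _ ha hb bI.
have [Bb pb] := pB _ _ _ (mx_comp_homog A ha) (mx_comp_homog A hb) AbJ.
by rewrite !mx_comp_mul; split=> // z /pa /pb.
Qed.

Lemma pullback_ext (k : fieldType) m n (I : prime_idealr {mpoly k[m]})
    (J : prime_idealr {mpoly k[n]}) (A : 'M[k]_(m, n))
    (phi psi : funfield I -> funfield J) :
  is_pullback A phi -> is_pullback A psi -> phi =1 psi.
Proof.
move=> pA pB z; have [d [a [b [ha hb bI ez]]]] := funfieldP z.
have [[_ e1] [_ e2]] := (pA _ _ _ ha hb bI, pB _ _ _ ha hb bI).
by apply: val_inj; rewrite /= (e1 _ ez) (e2 _ ez).
Qed.

(** * Uniqueness of the matrix of a pullback *)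

(** Let S be a right inverse of M. Testing on the vectors S e_a shows that N S is diagonal, testing
    on S (e_a + e_0) that its diagonal is constant, and N vanishes on ker M, so N = N S M. *)
Lemma pointwise_collinear_mx (k : fieldType) m n (M N : 'M[k]_(m, n)) :
  (1 < m)%N -> row_free M ->
  (forall (x : 'cV_n) i j,
     (N *m x) i 0 * (M *m x) j 0 = (N *m x) j 0 * (M *m x) i 0) ->
  exists c, N = c *: M.
Proof.
case: m M N => [|[|m]] // M N _ freeM H.
pose S := pinvmx M; have MS : M *m S = 1%:M.
  by rewrite -[M]mul1mx /S mulmxKp.
pose e a : 'cV[k]_m.+2 := delta_mx a 0.
have MSe y : M *m (S *m y) = y :> 'cV[k]_m.+2 by rewrite mulmxA MS mul1mx.
have D0 a b : b != a -> (N *m (S *m e a)) b 0 = 0.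
  move=> ba; have := H (S *m e a) b a; rewrite !MSe !mxE !eqxx (negPf ba) /=.
  by rewrite mulr1 mulr0.
(* For x in ker M, the vectors x + S e_a and S e_a have the same image under M. Coordinate b of N x
   is tested with some a different from b, which exists as M has at least two rows. *)
have kerN (x : 'cV_n) : M *m x = 0 -> N *m x = 0.
  move=> Mx; apply/colP => b; rewrite mxE [RHS]mxE.
  have [a ba] : exists a, b != a.
    have [->|b0] := eqVneq b 0; last by exists 0.
    by exists ord_max.
  have := H (x + S *m e a) b a; rewrite !mulmxDr Mx add0r MSe.
  have {}D0 := D0 _ _ ba; move: D0; rewrite !mxE !eqxx (negPf ba) /= => ->.
  by rewrite mulr1 mulr0 addr0.
(* The image of 1 - S M lies in ker M, where N vanishes. *)
have ND : N = N *m S *m M.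
  apply/eqP; rewrite -subr_eq0; apply/eqP/matrixP => i j.
  have Me : M *m (1%:M - S *m M) = 0 by rewrite mulmxBr mulmx1 mulmxA MS mul1mx subrr.
  pose x : 'cV[k]_n := (1%:M - S *m M) *m delta_mx j 0.
  have /kerN/colP/(_ i) : M *m x = 0 by rewrite mulmxA Me mul0mx.
  by rewrite mulmxA -colE mulmxBr mulmx1 mulmxA !mxE.
exists ((N *m S) 0 0); rewrite {1}ND -mul_scalar_mx; congr (_ *m _).
have De a b : (N *m S) b a = (N *m (S *m e a)) b 0.
  by rewrite mulmxA -colE [RHS]mxE.
apply/matrixP => b a; rewrite [RHS]mxE; case: eqVneq => [->|ba]; last first.
  by rewrite De D0 // mulr0n.
rewrite mulr1n; have [->//|a0] := eqVneq a 0.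
have := H (S *m (e a + e 0)) a 0.
have addE (v w : 'cV[k]_m.+2) i : (v + w) i 0 = v i 0 + w i 0 by rewrite mxE.
rewrite !MSe !mulmxDr !addE (D0 0 a) // (D0 a 0) 1?eq_sym //.
rewrite [e a _ _]mxE [e a _ _]mxE [e 0 _ _]mxE [e 0 _ _]mxE.
rewrite !eqxx [0 == a]eq_sym (negPf a0) /=.
by rewrite !add0r !addr0 !mulr1 !De.
Qed.

Lemma mx_compXE (k : fieldType) m n (A : 'M[k]_(m, n)) i (x : 'cV[k]_n) :
  (mx_comp A 'X_i).@[fun j => x j 0] = (A *m x) i 0.
Proof.
by rewrite meval_mx_comp mevalXU mxE.
Qed.

Lemma dhomogXU (k : fieldType) m (i : 'I_m) : ('X_i : {mpoly k[m]}) \is 1.-homog.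
Proof. by rewrite dhomogX /= mdeg1. Qed.

Lemma mpolyXU_neq0 (k : fieldType) m (i : 'I_m) : ('X_i : {mpoly k[m]}) != 0.
Proof.
apply/eqP => /(congr1 (mcoeff U_(i))).
by rewrite mcoeffX eqxx mcoeff0 => /eqP; rewrite oner_eq0.
Qed.

(** The ratio X_i / X_j has the same pullback along both matrices. Cross-multiplying gives a
    quadratic form in J, hence zero, and evaluating it at points gives the hypothesis of
    [pointwise_collinear_mx]. *)
Lemma pullback_unique (k : fieldType) m n (I : prime_idealr {mpoly k[m]})
    (J : prime_idealr {mpoly k[n]}) (A B : 'M[k]_(m, n))
    (phi : funfield I -> funfield J) :
  (forall i, 'X_i \notin I) ->
  (forall q, q \is 2.-homog -> q \in J -> q = 0) ->
  (1 < m)%N -> row_free B -> is_pullback A phi -> is_pullback B phi ->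
  exists c, A = c *: B.
Proof.
move=> hI hJ m1 freeB pA pB; apply: pointwise_collinear_mx => // x i j.
have [z ez] := form_ratio_ex (dhomogXU k i) (dhomogXU k j) (hI j).
have [AJ eA] := pA _ _ _ (dhomogXU k i) (dhomogXU k j) (hI j).
have [BJ eB] := pB _ _ _ (dhomogXU k i) (dhomogXU k j) (hI j).
have := eA _ ez; rewrite (eB _ ez) => /(form_ratio_eq _ _ BJ AJ)/hJ h.
have {h} : mx_comp B 'X_i * mx_comp A 'X_j - mx_comp A 'X_i * mx_comp B 'X_j = 0.
  by apply: h; apply: rpredB; apply: (@dhomogM _ _ _ 1%N _ 1%N);
    apply/mx_comp_homog/dhomogXU.
move/(congr1 (meval (fun j => x j 0))); rewrite mevalB !mevalM !mx_compXE meval0.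
by move/eqP; rewrite subr_eq0 => /eqP; rewrite mulrC => <-; rewrite mulrC.
Qed.

(** A nonzero multiple of the equation has at least its degree. As [msize] is the degree plus one,
    the bound says that q has degree below [hdeg X]. *)
Lemma hideal_msize (k : fieldType) n (X : hypersurface k n.+1) q :
  (msize q <= hdeg X)%N -> q \in hideal X -> q = 0.
Proof.
move=> sq /asboolP[r eq]; apply/eqP; apply: contraTT sq => q0.
have f0 : heqn X != 0 by have [] := heqn_irr X.
have r0 : r != 0 by apply: contraNneq q0 => r0; rewrite eq r0 mul0r.
rewrite eq msizeM // -ltnNge /hdeg.
have: msize r != 0%N by rewrite msize_poly_eq0.
have: msize (heqn X) != 0%N by rewrite msize_poly_eq0.
by case: (msize r) (msize (heqn X)) => [|i] [|j] //= _ _; rewrite addnS ltnS leq_addl.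
Qed.

Lemma mpolyC_homog (k : fieldType) m (c : k) : (c%:MP : {mpoly k[m]}) \is 0.-homog.
Proof. by rewrite -[c%:MP]mulr1 mul_mpolyC; apply/dhomogZ/dhomog1. Qed.

Lemma dhomog_msize_le (k : fieldType) m d (q : {mpoly k[m]}) :
  q \is d.-homog -> (msize q <= d.+1)%N.
Proof.
move=> /dhomogP h; rewrite msizeE big_seq; elim/big_ind: _ => // [x y|e /h -> //].
by rewrite geq_max => -> ->.
Qed.

Lemma hideal_XU (k : fieldType) n (X : hypersurface k n.+1) i :
  (3 <= hdeg X)%N -> 'X_i \notin hideal X.
Proof.
move=> d3; apply/negP => /hideal_msize h; have /eqP := mpolyXU_neq0 k i; apply.
apply: h; apply: leq_trans (dhomog_msize_le (dhomogXU k i)) _.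
exact: leq_trans d3.
Qed.

Lemma hideal_homog2 (k : fieldType) n (X : hypersurface k n.+1) q :
  (3 <= hdeg X)%N -> q \is 2.-homog -> q \in hideal X -> q = 0.
Proof.
by move=> d3 /dhomog_msize_le h; apply: hideal_msize; apply: leq_trans h d3.
Qed.

Lemma pspace_XU (k : fieldType) n i : 'X_i \notin pspace_ideal k n.
Proof.
by apply/negP => /asboolP[q /eqP]; rewrite mulr0 (negPf (mpolyXU_neq0 _ _)).
Qed.

(** The normal factor K has p^u > 1 elements. *)
Lemma sdprod_nontrivial p u l (T : groupType) (G : {pred T}) : prime p ->
  (0 < u)%N -> iso_elementary_sdprod p u l G -> exists2 g, g \in G & g != 1%g.
Proof.
move=> pP u0 [gT [S [K [H [phi [defS isoK isoH [phiM phiI] GP]]]]]].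
have sKS : K \subset S by have [/normal_sub] := sdprod_context defS.
have : (1 < #|K|)%N.
  rewrite (card_isog isoK) cardsT card_mx mul1n card_ord (Zp_cast (prime_gt1 pP)).
  apply: leq_trans (prime_gt1 pP) _.
  by rewrite -[leqLHS]expn1 leq_exp2l ?prime_gt1.


rewrite cardG_gt1 => /trivgPn[x xK x1].
have xS : x \in S by apply: (subsetP sKS).
have phi1 : phi 1%g = 1%g by apply: (mulgI (phi 1%g)); rewrite -phiM // mulg1 mulg1.
exists (phi x); first by apply/GP; exists x.
by apply: contraNneq x1; rewrite -phi1 => /(phiI _ _ xS (group1 S))->.
Qed.

(** * From a Galois point to a lift with a common one-dimensional image *)

Section GaloisGroupLift.
Variables (k : fieldType) (n : nat) (n_ge1 : (1 <= n)%N).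
Variables (X : hypersurface k n.+1) (P : 'cV[k]_n.+2).
Variables (iota : {rmorphism kP k n -> kX X}) (G : {pred PGL k n.+2}).
Hypotheses (X_ge3 : (3 <= hdeg X)%N) (galG : is_galois_group iota G).
Hypotheses (G_group : group_closed G).

Lemma galois_group_lift : projection_pullback P iota ->
  exists G' : {pred GL k n.+2}, [/\ group_closed G', pr_isom G' G
    & forall B C : GL k n.+2, B \in G' -> C \in G' -> B != 1%g -> C != 1%g ->
        \rank ((B : 'M[k]_n.+2) - 1%:M) = 1%N /\
        same_image ((B : 'M[k]_n.+2) - 1%:M) ((C : 'M[k]_n.+2) - 1%:M)].
Proof.
case=> M [rM _] pM.
have freeM : row_free M by rewrite -row_leq_rank rM.
have M0 : M != 0 by rewrite -mxrank_eq0 rM.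
(* As M is nonzero, the normalisation M A = M selects at most one matrix in each scalar class. *)
pose G' : {pred GL k n.+2} := fun A =>
  (pr A \in G) && (M *m (A : 'M[k]_n.+2) == M).
have G'P A : reflect (pr A \in G /\ M *m (A : 'M[k]_n.+2) = M) (A \in G').
  by apply: (iffP andP) => -[? /eqP].
exists G'; split.
- split=> [|A B /G'P[AG MA] /G'P[BG MB]].
    by apply/G'P; rewrite pr1g mulmx1; case: G_group.
  apply/G'P; rewrite prMg prVg; split; first by have [_] := G_group; apply.
  rewrite GLmxM mulmxA MA -[in LHS]MB -mulmxA /= mulmxV ?mulmx1 //.
  exact: Defs.GL_unit.
- split=> [A B /G'P[_ MA] /G'P[_ MB] /prP[c c0 e]|g].
    apply: val_inj; rewrite /= e; move: MA; rewrite e -scalemxAr MB => /eqP.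
    rewrite -subr_eq0 -[X in _ - X]scale1r -scalerBl scaler_eq0 (negPf M0) orbF.
    by rewrite subr_eq0 => /eqP->; rewrite scale1r.
  split=> [gG|[A /G'P[AG _] <- //]].
  have [s [_ siota] [A [eg _ pA]]] := (galG g).1 gG.
  (* Since s fixes the functions coming from P^n, the map [iota] is also the pullback along x |-> M
     A x, so [pullback_unique] compares M A with M. *)
  have pMA : is_pullback (M *m (A : 'M[k]_n.+2)) iota.
    move=> d a b ha hb bI; have [h1 h2] := pullback_comp pM pA ha hb bI.
    by split=> // z ez; rewrite -(h2 _ ez) /= siota.
  have [c e] : exists c, M *m (A : 'M[k]_n.+2) = c *: M.
    apply: (@pullback_unique _ _ _ _ _ _ _ iota) => //.
    + exact: pspace_XU.
    + by move=> q; apply: hideal_homog2.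
  have c0 : c != 0.
    apply: contraNneq M0 => c0; rewrite c0 scale0r in e.
    by rewrite -[M](mulmxK (Defs.GL_unit A)) e mul0mx.
  have cU : c^-1 *: (A : 'M[k]_n.+2) \in unitmx.
    by rewrite unitmxZ ?unitfE ?invr_eq0 // Defs.GL_unit.
  have prA : pr (mkGL cU) = g.
    by rewrite -eg; apply/prP; exists c^-1; rewrite ?invr_eq0.
  exists (mkGL cU) => //; apply/G'P; rewrite prA; split=> //=.
  by rewrite -scalemxAr e scalerA mulVf // scale1r.
have im B : B \in G' -> B != 1%g ->
    \rank ((B : 'M[k]_n.+2) - 1%:M) = 1%N /\
    (((B : 'M[k]_n.+2) - 1%:M)^T :=: kermx M^T)%MS.
  move=> /G'P[_ MB] B1.
  have B0 : (B : 'M[k]_n.+2) - 1%:M != 0.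
    by apply: contraNneq B1 => /eqP; rewrite subr_eq0 => /eqP e; apply/eqP/val_inj.
  (* Transposing M (B - 1) = 0 puts the image of B - 1 inside ker M, which is a line; B - 1 is
     nonzero, so equality follows. *)
  have sub : (((B : 'M[k]_n.+2) - 1%:M)^T <= kermx M^T)%MS.
    by apply/sub_kermxP; rewrite -trmx_mul mulmxBr MB mulmx1 subrr trmx0.
  have rk : \rank (kermx M^T) = 1%N by rewrite mxrank_ker mxrank_tr rM subSnn.
  have r1 : \rank ((B : 'M[k]_n.+2) - 1%:M) = 1%N.
    have := mxrankS sub; rewrite rk mxrank_tr => h.
    by apply/eqP; rewrite eqn_leq h lt0n mxrank_eq0.
  split=> //; apply/eqmxP; rewrite -(geq_leqif (mxrank_leqif_eq sub)).
  by rewrite rk mxrank_tr r1.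
move=> B C /im hB /im hC /hB[rB iB] /hC[_ iC]; split=> //.
exact: eqmx_trans iB (eqmx_sym iC).
Qed.

End GaloisGroupLift.

(** * Galois extensions generated by one element *)

Section SimpleGalois.
Variables (K L : fieldType) (iota : {rmorphism K -> L}) (I : finType).
Variables (sg : I -> {rmorphism L -> L}) (z : L) (f : {poly K}).
Local Notation "q ^i" := (map_poly iota q) (at level 2, format "q ^i").

Hypothesis sg_iota : forall i a, sg i (iota a) = iota a.
Hypothesis sg_inj : injective (fun i => sg i z).
Hypothesis sg_id : exists i, sg i z = z.
Hypothesis size_f : size f = #|I|.+1.
Hypothesis root_f : root f^i z.
Hypothesis gen_z : forall y, exists q r : {poly K}, y = q^i.[z] / r^i.[z].

Let rs := [seq sg i z | i : I].

Lemma root_fixing (s : {rmorphism L -> L}) q : (forall a, s (iota a) = iota a) ->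
  root q^i z -> root q^i (s z).
Proof.
move=> sK /rootP qz; apply/rootP.
have -> : q^i = map_poly s q^i.
  by rewrite -map_poly_comp; apply: eq_map_poly => a /=; rewrite sK.
by rewrite horner_map qz rmorph0.
Qed.

Let uniq_rs : uniq rs.
Proof. by rewrite map_inj_uniq ?enum_uniq. Qed.

Let size_rs : size rs = #|I|.
Proof. by rewrite size_map -cardE. Qed.

Let root_rs q : root q^i z -> all (root q^i) rs.
Proof.
by move=> qz; apply/allP => _ /mapP[i _ ->]; apply: root_fixing qz; apply: sg_iota.
Qed.

Let f_neq0 : f != 0.
Proof. by rewrite -size_poly_gt0 size_f. Qed.

(** A nonzero polynomial over K that vanishes at z vanishes at all [#|I|] distinct conjugates
    [sg i z], so its degree is at least that of f. *)
Let f_irr : irreducible_poly f.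
Proof.
apply/(subfx_irreducibleP root_f f_neq0) => q qz q0; rewrite size_f.
have := max_poly_roots _ (root_rs qz) uniq_rs.
by rewrite map_poly_eq0 size_rs size_map_poly; apply.
Qed.

Let fE : f^i = lead_coef f^i *: \prod_(x <- rs) ('X - x%:P).
Proof.
apply: all_roots_prod_XsubC; last by rewrite uniq_rootsE.
- by rewrite size_map_poly size_f size_rs.
- exact: root_rs.
Qed.

(** The image of z is a root of f, and the [sg i z] are all the roots. *)
Lemma galois_aut_simple (s : {rmorphism L -> L}) :
  galois_aut iota s -> exists i, s z = sg i z.
Proof.
move=> [_ sK]; have := root_fixing sK root_f.
rewrite fE rootZ ?lead_coef_eq0 ?map_poly_eq0 // root_prod_XsubC.
by case/mapP => i _ ->; exists i.
Qed.

(** The model E is the extension of K by a root of f, mapped onto L because z generates L. It is a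
    splitting field of f, and f is separable since its roots in L are distinct. *)
Lemma is_galois_simple : is_galois iota.
Proof.
pose E0 := SubFieldExtType root_f f_irr.
pose j : {rmorphism E0 -> L} := @subfx_inj _ _ iota z f.
have jK a : j a%:A = iota a by apply: (subfx_inj_base root_f f_neq0).
have jz : j (@subfx_root _ _ iota z f) = z by apply: (subfx_inj_root root_f f_neq0).
have jq q : exists x, j x = q^i.[z].
  by exists (@subfx_eval _ _ iota z f q); apply: (subfx_inj_eval root_f f_neq0).
have jI : injective j by apply: fmorph_inj.
have jS y : exists x, j x = y.
  have [q [r ->]] := gen_z y; have [[a <-] [b <-]] := (jq q, jq r).
  by exists (a / b); rewrite fmorph_div.
have jbij : bijective j.
  exists (fun y => sval (cid (jS y))) => y; last exact: (svalP (cid (jS y))).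
  by apply: jI; apply: (svalP (cid (jS (j y)))).
have [g jg gj] := jbij.
have fsplit : splittingFieldFor 1 (map_poly (in_alg E0) f) {:E0}.
  exists (map g rs).
    suff -> : map_poly (in_alg E0) f =
        lead_coef (map_poly (in_alg E0) f) *: \prod_(x <- map g rs) ('X - x%:P).
      rewrite eqp_scale // lead_coef_eq0 map_poly_eq0.
      exact: f_neq0.
    apply: (map_poly_inj j).
    rewrite -map_poly_comp (eq_map_poly jK) {1}fE map_polyZ /= rmorph_prod.
    congr (_ *: _).
      rewrite -lead_coef_map -map_poly_comp; congr lead_coef.
      by apply: eq_map_poly => a; rewrite /= jK.
    rewrite big_map; apply: eq_bigr => x _.
    by rewrite rmorphB /= map_polyX map_polyC /= gj.
  (* E0 is generated by the preimage of z, which is among the listed roots because some [sg i] fixes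
     z. *)
  apply/eqP; rewrite eqEsubv subvf /=; apply/subvP => x _.
  have [q ->] := subfxEroot root_f f_neq0 x.
  apply: rpred_horner.
    by apply/polyOverP => i; rewrite coef_map; apply/memvZ/mem1v.
  have [i siz] := sg_id; apply: seqv_sub_adjoin.
  have -> : subfx_root iota z f = g z by rewrite -[in RHS]jz jg.
  by apply: map_f; rewrite -siz; apply: map_f; rewrite mem_enum.
pose E : splittingFieldType K := HB.pack E0
  (FieldExt_isSplittingField.Build K E0
    (ex_intro2 _ _ (map_poly (in_alg E0) f) (alg_polyOver _ f) fsplit)).
exists E, j; split=> //.
apply/splitting_galoisField; exists (map_poly (in_alg E0) f); split => //.
  exact: alg_polyOver.
have : separable_poly (\prod_(x <- rs) ('X - x%:P)) by rewrite separable_prod_XsubC.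
have lc0 : lead_coef f^i != 0 by rewrite lead_coef_eq0 map_poly_eq0; apply: f_neq0.
by rewrite -(eqp_separable (eqp_scale _ lc0)) -fE !separable_map.
Qed.
End SimpleGalois.

(** * Construction of the hypersurface *)

(** Induction over forms that keeps track of the degree, starting from constants and variables. The
    zero polynomial is required in every degree, as the empty sum of monomials. *)
Lemma dhomog_ind (k : fieldType) m (Q : nat -> {mpoly k[m]} -> Prop) :
  (forall d, Q d 0) -> (forall d a b, Q d a -> Q d b -> Q d (a + b)) ->
  (forall d e a b, Q d a -> Q e b -> Q (d + e)%N (a * b)) ->
  (forall c, Q 0%N c%:MP) -> (forall i, Q 1%N 'X_i) ->
  forall d a, a \is d.-homog -> Q d a.
Proof.
move=> Q0 QD QM QC QX d a /dhomogP ha; rewrite [a]mpolyE big_seq.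
elim/big_ind: _ => [||e he]; [exact: Q0|exact: QD|].
rewrite -mul_mpolyC -[d]add0n; apply: (QM); first exact: QC.
rewrite -(ha e he) mpolyXE_id /= mdegE.
elim/big_ind2: _ => [|x1 d1 x2 d2 h1 h2|i _]; first by rewrite -mpolyC1; apply: (QC).
  exact: (QM).
elim: (e i) => [|j IH]; first by rewrite expr0 -mpolyC1; apply: (QC).
by rewrite exprS -add1n; apply: (QM).
Qed.

Lemma irreducible_elt_can (R S : idomainType) (h : {rmorphism R -> S})
    (h' : {rmorphism S -> R}) x :
  cancel h h' -> cancel h' h -> irreducible_elt (h x) -> irreducible_elt x.
Proof.
move=> hK h'K [h0 hU hI]; split.
- by apply: contraNneq h0 => ->; rewrite rmorph0.
- by move: hU; rewrite (unit_of_can _ hK).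
- move=> a b e; have := hI (h a) (h b); rewrite -rmorphM -e !(unit_of_can _ hK).
  exact.
Qed.

(** The degrees of two factors add up to 1, so one factor is a nonzero constant. *)
Lemma irreducible_mpolyX (k : fieldType) m (i : 'I_m) :
  irreducible_elt ('X_i : {mpoly k[m]}).
Proof.
have Xn : ('X_i : {mpoly k[m]}) != 0 by apply: mpolyXU_neq0.
split=> // [|a b e].
  apply/negP => /unitrP[q [/(congr1 (meval (fun=> 0))) + _]].
  by rewrite mevalM mevalXU mulr0 meval1 => /eqP; rewrite eq_sym oner_eq0.
have cU (c : {mpoly k[m]}) : c != 0 -> (msize c <= 1)%N -> c \is a GRing.unit.
  move=> c0 /msize1_polyC cE; move: c0; rewrite cE mpolyC_eq0 => x0.
  by rewrite rmorph_unit // unitfE.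
have [a0 b0] : a != 0 /\ b != 0.
  by apply/andP; rewrite -negb_or -mulf_eq0 -e.
have := msizeM a0 b0; rewrite -e msizeX mdeg1 => s2.
have [/cU|sa] := leqP (msize a) 1; first by left; auto.
right; apply: cU => //; move: sa s2.
by move: (msize a) (msize b) => x y; lia.
Qed.

(* Eisenstein's criterion for the reversed polynomial. *)
Lemma irreducible_poly_lead (R S : idomainType) (ev : {rmorphism R -> S})
    (q : {poly R}) c :
  (1 < size q)%N -> irreducible_elt (lead_coef q) ->
  c != 0 -> map_poly ev q = c%:P -> irreducible_elt q.
Proof.
move=> sq [_ _ lI] c0 ec; have q0 : q != 0 by rewrite -size_poly_gt0 ltnW.
split=> // [|a b e].
  by apply: contraTN sq => /size_poly_unit ->.
(* The factors of a nonzero constant are constant, so [ev] maps both factors to constants. A unit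
   leading coefficient survives [ev], hence [a'] was constant already. *)
have main (a' b' : {poly R}) : q = a' * b' -> lead_coef a' \is a GRing.unit ->
    a' \is a GRing.unit.
  move=> e' aU; have [a0 b0] : map_poly ev a' != 0 /\ map_poly ev b' != 0.
    by apply/andP; rewrite -negb_or -mulf_eq0 -rmorphM /= -e' ec polyC_eq0.
  have sa : size (map_poly ev a') = size a'.
    apply: size_map_poly_id0; apply: contraTneq (rmorph_unit ev aU) => ->.
    by rewrite unitr0.
  have := size_mul a0 b0; rewrite -rmorphM /= -e' ec size_polyC c0 sa => s1.
  have sb : (0 < size (map_poly ev b'))%N by rewrite size_poly_gt0.
  have sa0 : (0 < size a')%N by rewrite -sa size_poly_gt0.
  have /eqP s1a : size a' == 1%N.
    by move: s1 sb sa0; rewrite /=; move: (size a') (size (map_poly _ b')) => x y; lia.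
  rewrite poly_unitE s1a eqxx; move: aU; rewrite lead_coefE s1a; exact.
have := lI (lead_coef a) (lead_coef b); rewrite e lead_coefM => /(_ erefl).
case=> [/(main _ _ e)|bU]; [by left | right].
by apply: (main b a) => //; rewrite e mulrC.
Qed.

Lemma unitmx_to_delta (k : fieldType) r (v : 'cV[k]_r) (j : 'I_r) : v != 0 ->
  exists2 T : 'M[k]_r, T \in unitmx & T *m v = delta_mx j 0.
Proof.
move=> v0; have /matrix0Pn[i [i' vi]] := v0; rewrite (ord1 i') in vi.
(* This rank-one matrix maps the row v^T to the required basis row; [complete_unitmx] then finds an
   invertible matrix with the same value on v^T. *)
pose f : 'M[k]_r := (v i 0)^-1 *: delta_mx i j.
have vf : v^T *m f = delta_mx 0 j.
  apply/rowP => h; rewrite -scalemxAr mxE mxE (bigD1 i) //= big1 => [|l li].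
    by rewrite !mxE !eqxx addr0 /= mulrA mulVf // mul1r.
  by rewrite !mxE (negPf li) mulr0.
have rk : \rank (v^T *m f) = \rank v^T.
  by rewrite vf mxrank_delta mxrank_tr -mxrank_tr rank_rV trmx_eq0 v0.
have [g gU eg] := complete_unitmx rk.
exists g^T; first by rewrite unitmx_tr.
by rewrite -[v]trmxK -trmx_mul -eg vf trmx_delta.
Qed.

Lemma bigmin_le_mem (T : eqType) (f : T -> nat) x0 (s : seq T) m : m \in s ->
  (\big[minn/x0]_(i <- s) f i <= f m)%N.
Proof.
elim: s => // a s IH; rewrite inE big_cons => /orP[/eqP->|/IH h].
  exact: geq_minl.
exact: leq_trans (geq_minr _ _) h.
Qed.

Lemma pullback_eq (k : fieldType) m n (I : prime_idealr {mpoly k[m]})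
    (J : prime_idealr {mpoly k[n]}) (A : 'M[k]_(m, n))
    (phi psi : funfield I -> funfield J) :
  phi =1 psi -> is_pullback A phi -> is_pullback A psi.
Proof.
move=> e pA d a b ha hb bI; have [h1 h2] := pA d a b ha hb bI.
by split=> // z; rewrite -e; apply: h2.
Qed.

Lemma pullback_id (k : fieldType) m (I : prime_idealr {mpoly k[m]}) :
  is_pullback (1%:M : 'M[k]_m) (id : funfield I -> funfield I).
Proof. by move=> d a b ha hb bI; rewrite !mx_comp1. Qed.

Lemma mx_compX_inj (k : fieldType) m n (A B : 'M[k]_(m, n)) i :
  mx_comp A 'X_i = mx_comp B 'X_i -> row i A = row i B.
Proof.
move=> e; apply/rowP => j; rewrite !mxE.
have := mx_compXE A i (delta_mx j 0); rewrite e mx_compXE.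
by rewrite -!colE !mxE.
Qed.

(** A linear coefficient is the constant term of a partial derivative, so this is the Leibniz rule
    at the origin. *)
Lemma mcoeff_U_mul (k : fieldType) m (a b : {mpoly k[m]}) j :
  a@_0%MM = 0 -> (a * b)@_U_(j) = a@_U_(j) * b@_0%MM.
Proof.
move=> a0; have E (c : {mpoly k[m]}) : c@_U_(j) = (c^`M(j))@_0%MM.
  by rewrite mcoeff_deriv add0m mnm0E mulr1n.
by rewrite !E mderivM mcoeffD !rmorphM /= a0 mul0r addr0.
Qed.

Lemma muni_mwiden (k : fieldType) m (q : {mpoly k[m]}) : muni (mwiden q) = q%:P.
Proof. by rewrite -mpoly_of_uniC mpoly_of_uniK. Qed.

Lemma muniX (k : fieldType) m : muni 'X_ord_max = 'X :> {poly {mpoly k[m]}}.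
Proof. by rewrite -mpoly_of_uniX mpoly_of_uniK. Qed.

Lemma irreducible_elt_mulr_unit (R : idomainType) (x e : R) :
  e \is a GRing.unit -> irreducible_elt x -> irreducible_elt (x * e).
Proof.
move=> eU [h0 hU hI]; have e0 : e != 0 by apply: contraTneq eU => ->; rewrite unitr0.
split; rewrite ?mulf_neq0 ?unitrM ?eU ?andbT // => a b e'.
have := hI a (b * e^-1); rewrite mulrA -e' mulrK // unitrM unitrV eU andbT.
exact.
Qed.

Lemma polyC_eq_mul (R : idomainType) (c : R) (a b : {poly R}) :
  c%:P = a * b -> (1 < size b)%N -> c = 0.
Proof.
move=> e sb; apply/eqP; rewrite -polyC_eq0; apply: contraT => c0.
move: (c0); rewrite e mulf_eq0 negb_or => /andP[a0 b0].
have := size_polyC_leq1 c; rewrite e size_mul //.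
by move: a0; rewrite -size_poly_gt0; move: (size a) (size b) sb => x y; lia.
Qed.

(** * Products of linear polynomials plus a constant *)

Section ProdLinear.
Variables (K : idomainType) (I : finType) (a b : I -> K) (c : K).
Hypotheses (I_gt0 : (0 < #|I|)%N) (a_neq0 : forall i, a i != 0).

(** This is the shape of the equation of the hypersurface divided by y_0^d, read as a polynomial in
    y_t / y_0. *)
Definition prod_linear : {poly K} := \prod_i (a i *: 'X + (b i)%:P) + c%:P.

Let size_linear i : size (a i *: 'X + (b i)%:P) = 2%N.
Proof. by rewrite size_polyDl size_scale ?size_polyX // ltnS size_polyC_leq1. Qed.

Lemma size_prod_linear : size (\prod_i (a i *: 'X + (b i)%:P)) = #|I|.+1.
Proof.
rewrite size_prod => [|i _]; last by rewrite -size_poly_gt0 size_linear.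
rewrite (eq_bigr (fun=> 2%N)) => [|i _]; last exact: size_linear.
rewrite sum_nat_const; transitivity ((#|I| * 2).+1 - #|I|)%N => //.
by rewrite muln2 -addnn subSn ?leq_addr // addnK.
Qed.

Lemma size_prod_linearD : size prod_linear = #|I|.+1.
Proof.
rewrite size_polyDl size_prod_linear //.
by apply: leq_ltn_trans (size_polyC_leq1 _) _; rewrite ltnS.
Qed.

Lemma lead_coef_prod_linear :
  lead_coef (\prod_i (a i *: 'X + (b i)%:P)) = \prod_i a i.
Proof.
rewrite lead_coef_prod; apply: eq_bigr => i _.
by rewrite lead_coefE size_linear coefD coefZ coefX coefC mulr1 addr0.
Qed.

Lemma horner_prod_linear (L : idomainType) (iota : {rmorphism K -> L}) z :
  (map_poly iota prod_linear).[z] = \prod_i (iota (a i) * z + iota (b i)) + iota c.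
Proof.
rewrite rmorphD rmorph_prod /= map_polyC hornerD hornerC horner_prod; congr (_ + _).
apply: eq_bigr => i _.
by rewrite rmorphD /= map_polyZ map_polyX map_polyC hornerD hornerZ hornerX hornerC.
Qed.

End ProdLinear.

Section FunfieldVal.
Variables (k : fieldType) (m : nat) (I : prime_idealr {mpoly k[m]}).
Lemma ffval0 : ffval (0 : funfield I) = 0.
Proof. exact: (rmorph0 val). Qed.
Lemma ffvalD (x y : funfield I) : ffval (x + y) = ffval x + ffval y.
Proof. by rewrite /=. Qed.
Lemma ffvalM (x y : funfield I) : ffval (x * y) = ffval x * ffval y.
Proof. by rewrite /=. Qed.
Lemma ffvalX (x : funfield I) e : ffval (x ^+ e) = ffval x ^+ e.
Proof. by elim: e => // e IH; rewrite !exprS ffvalM IH. Qed.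
Lemma ffval_prod (K : finType) (x : K -> funfield I) :
  ffval (\prod_i x i) = \prod_i ffval (x i).
Proof. by elim/big_rec2: _ => // i a b _ <-; rewrite ffvalM. Qed.
End FunfieldVal.

(** * The equation, its irreducibility and the multiplicity at v *)

Section Construction.
Variables (k : fieldType) (n : nat) (n_ge1 : (1 <= n)%N).
Variables (I : finType) (beta : I -> GL k n.+2) (v : 'cV[k]_n.+2).
Hypothesis I_gt1 : (1 < #|I|)%N.
Hypothesis beta_inj : injective beta.
Hypothesis beta1 : exists i, beta i = 1%g.
Hypothesis betaM : forall i j, exists h, beta h = (beta i * beta j)%g.
Hypothesis betaV : forall i, exists j, beta j = ((beta i)^-1)%g.
Hypothesis v_neq0 : v != 0.
Hypothesis beta_v : forall i, exists w, (beta i : 'M[k]_n.+2) - 1%:M = v *m w.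

(** [x0] and [x1] index y_0 and y_n, which differ because n is positive; [xt] indexes y_t, the
    coordinate along v. *)
Let x0 : 'I_n.+1 := ord0.
Let x1 : 'I_n.+1 := ord_max.
Let xt : 'I_n.+2 := ord_max.

Lemma x1_neq_x0 : x1 != x0.
Proof. by rewrite /x0 /x1 -val_eqE /= -lt0n. Qed.

Variable T : 'M[k]_n.+2.
Hypothesis TU : T \in unitmx.
Hypothesis Tv : T *m v = delta_mx xt 0.

(** [E] drops the coordinate y_t, so [M] is the projection from v in the original coordinates, and
    [C i] is [beta i] in the coordinates given by [T]. *)
Let E : 'M[k]_(n.+1, n.+2) := \matrix_(i, j) (widen_ord (leqnSn n.+1) i == j)%:R.
Let M := E *m T.
Let C i : 'M[k]_n.+2 := T *m (beta i : 'M[k]_n.+2) *m invmx T.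

Lemma E_delta : E *m (delta_mx xt 0 : 'cV_n.+2) = 0.
Proof.
apply/colP => i; rewrite -colE !mxE -val_eqE /=; case: eqP => // ei.
by have := ltn_ord i; rewrite ei ltnn.
Qed.

Lemma T_beta i : T *m (beta i : 'M[k]_n.+2) = C i *m T.
Proof. by rewrite /C mulmxKV. Qed.

Lemma C_rank1 i : exists c : 'rV[k]_n.+2, C i = 1%:M + delta_mx xt 0 *m c.
Proof.
have [w e] := beta_v i; exists (w *m invmx T).
rewrite /C; have -> : (beta i : 'M[k]_n.+2) = 1%:M + v *m w by rewrite -e addrC subrK.
by rewrite mulmxDr mulmx1 mulmxDl mulmxV // mulmxA Tv -!mulmxA.
Qed.

Lemma E_C i : E *m C i = E.
Proof.
by have [c ->] := C_rank1 i; rewrite mulmxDr mulmx1 mulmxA E_delta mul0mx addr0.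
Qed.

Lemma M_beta i : M *m (beta i : 'M[k]_n.+2) = M.
Proof. by rewrite /M -mulmxA T_beta mulmxA E_C. Qed.

Let cc i : 'rV[k]_n.+2 := sval (cid (C_rank1 i)).
(** [C i] pulls y_t back to [aa i] times y_t plus the linear form [ww i] in y_0, ..., y_n. *)
Let aa i : k := 1 + cc i 0 xt.
Let ww i : {mpoly k[n.+1]} := \sum_j cc i 0 (widen_ord (leqnSn n.+1) j) *: 'X_j.

Lemma C_delta i : C i *m (delta_mx xt 0 : 'cV_n.+2) = aa i *: delta_mx xt 0.
Proof.
rewrite (svalP (cid (C_rank1 i))) -/(cc i) mulmxDl mul1mx -mulmxA -colE.
apply/colP => j; rewrite mxE [in LHS]mxE mxE big_ord1 !mxE /aa eqxx andbT.
by rewrite mulrDl mul1r mulrC.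
Qed.

(** It is an eigenvalue of the invertible matrix [C i]. *)
Lemma aa_neq0 i : aa i != 0.
Proof.
apply/negP => /eqP a0; have := C_delta i; rewrite a0 scale0r.
have CU : C i \in unitmx by rewrite !unitmx_mul TU Defs.GL_unit unitmx_inv TU.
move=> /(congr1 (mulmx (invmx (C i)))); rewrite mulmxA mulVmx // mul1mx mulmx0.
by move=> /matrixP/(_ xt 0); rewrite !mxE !eqxx => /eqP; rewrite oner_eq0.
Qed.

Lemma mx_comp_E q : mx_comp E q = mwiden q.
Proof.
move: q; apply: (@mpoly_rmorph_ext _ _ _ (mx_comp E) (@mwiden n.+1 k)).
  by move=> c; rewrite /= mx_compC mwidenC.
move=> i; rewrite /= mx_compX (bigD1 (widen_ord (leqnSn n.+1) i)) //= big1.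
  by rewrite mxE eqxx scale1r addr0 mwidenX mnmwiden1.
by move=> j ji; rewrite mxE eq_sym (negPf ji) scale0r.
Qed.

Lemma mx_comp_C i : mx_comp (C i) 'X_xt = aa i *: 'X_xt + mwiden (ww i).
Proof.
rewrite mx_compX big_ord_recr /= addrC; congr (_ *: _ + _).
  by rewrite (svalP (cid (C_rank1 i))) -/(cc i) !mxE big_ord1 !mxE !eqxx mul1r.
rewrite /ww raddf_sum /=; apply: eq_bigr => j _.
rewrite mwidenZ mwidenX mnmwiden1; congr (_ *: _).
rewrite (svalP (cid (C_rank1 i))) -/(cc i) !mxE big_ord1 !mxE !eqxx mul1r.
rewrite -val_eqE /= gtn_eqF ?add0r //; exact: ltn_ord.
Qed.

(** One more than the group order, so that projecting from a simple point has degree [#|I|]. *)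
Let d := #|I|.+1.

(* X is F = 0 with F = F0 o T; in the coordinates given by T, G' acts by the C i. *)
Let F0 : {mpoly k[n.+2]} :=
  mx_comp E 'X_x0 * \prod_i mx_comp (C i) 'X_xt + mx_comp E 'X_x1 ^+ d.
Let F := mx_comp T F0.

(** In this form invariance is visible: [M] is fixed by every [beta i], and the product runs over an
    orbit. *)
Lemma FE : F =
  mx_comp M 'X_x0 * \prod_i mx_comp (T *m (beta i : 'M[k]_n.+2)) 'X_xt
  + mx_comp M 'X_x1 ^+ d.
Proof.
rewrite /F /F0 rmorphD rmorphM rmorph_prod rmorphXn /= -!mx_comp_mul.
rewrite (eq_bigr (fun i => mx_comp (T *m (beta i : 'M[k]_n.+2)) 'X_xt)) // => i _.
by rewrite -mx_comp_mul T_beta.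
Qed.

Lemma homog_F : F \is d.-homog.
Proof.
rewrite FE; apply: rpredD; last first.
  by have := dhomogMn d (mx_comp_homog M (dhomogXU k x1)); rewrite mul1n.
apply: (@dhomogM _ _ _ 1%N _ #|I|); first exact/mx_comp_homog/dhomogXU.
rewrite -sum1_card; elim/big_ind2: _ => [|a da b db ha hb|i _].
- exact: dhomog1.
- exact: dhomogM.
- exact/mx_comp_homog/dhomogXU.
Qed.

Lemma muni_F0 : muni F0 = ('X_x0)%:P *
  \prod_i ((aa i)%:MP *: 'X + (ww i)%:P) + ('X_x1 ^+ d)%:P.
Proof.
rewrite /F0 rmorphD rmorphM rmorph_prod rmorphXn /= !mx_comp_E !muni_mwiden.
rewrite rmorphXn /=; congr (_ * _ + _); apply: eq_bigr => i _.
by rewrite mx_comp_C rmorphD /= muniZ muniX muni_mwiden.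
Qed.

Lemma aaC_neq0 i : (aa i)%:MP != 0 :> {mpoly k[n.+1]}.
Proof. by rewrite mpolyC_eq0 aa_neq0. Qed.

Lemma size_prod_f0 : size (\prod_i ((aa i)%:MP *: 'X + (ww i)%:P)) = d.
Proof. exact: (size_prod_linear ww aaC_neq0). Qed.

Lemma size_muni_F0 : size (muni F0) = d.
Proof.
have X0 : ('X_x0 : {mpoly k[n.+1]}) != 0 by apply: mpolyXU_neq0.
rewrite muni_F0 size_polyDl mul_polyC size_scale // size_prod_f0 //.
by apply: leq_ltn_trans (size_polyC_leq1 _) _; rewrite ltnS ltnW.
Qed.

(** As a polynomial in y_t, F0 has leading coefficient y_0 times a unit, which is irreducible.
    Setting y_0 = 0 and the other y_j = 1 leaves the constant 1, so [irreducible_poly_lead]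
    applies. *)
Lemma F0_irr : irreducible_elt F0.
Proof.
suff : irreducible_elt (muni F0).
  exact: (irreducible_elt_can (@muniK k n.+1) (@mpoly_of_uniK k n.+1)).
pose ev : {rmorphism {mpoly k[n.+1]} -> k} := meval (fun j => (j != x0)%:R : k).
apply: (@irreducible_poly_lead _ _ ev _ 1); rewrite ?oner_neq0 //.
- by rewrite size_muni_F0 /d ltnS ltnW.
- rewrite muni_F0 lead_coefDl; last first.
    rewrite mul_polyC size_scale ?mpolyXU_neq0 // size_prod_f0.
    by apply: leq_ltn_trans (size_polyC_leq1 _) _; rewrite ltnS ltnW.
  rewrite lead_coefM lead_coefC (lead_coef_prod_linear ww aaC_neq0).
  have irrX := irreducible_mpolyX k x0; apply: irreducible_elt_mulr_unit irrX.
  elim/big_ind: _ => [|a b aU bU|i _]; rewrite ?unitr1 ?unitrM ?aU //.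
  by rewrite rmorph_unit // unitfE aa_neq0.
- rewrite muni_F0 rmorphD rmorphM /= !map_polyC /= rmorphXn /= !mevalXU eqxx x1_neq_x0.
  by rewrite mul0r add0r expr1n.
Qed.

Lemma F_irr : irreducible_elt F.
Proof.
have TK : cancel (mx_comp (invmx T)) (mx_comp T).
  by move=> q; rewrite -mx_comp_mul mulVmx // mx_comp1.
have KT : cancel (mx_comp T) (mx_comp (invmx T)).
  by move=> q; rewrite -mx_comp_mul mulmxV // mx_comp1.
suff : irreducible_elt (mx_comp (invmx T) F) by apply: (irreducible_elt_can TK KT).
by rewrite /F KT; apply: F0_irr.
Qed.

Lemma F_homog : F \is homog mdeg.
Proof. by apply/homogP; exists d; apply: homog_F. Qed.

Definition galois_hypersurface : hypersurface k n.+1 := Hypersurface F_homog F_irr.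
Local Notation X := galois_hypersurface.

Lemma hdeg_X : hdeg X = d.
Proof.
have F_neq0 : F != 0 by have [] := F_irr.
exact: dhomog_uniq F_neq0 (dhomog_msize homog_F) homog_F.
Qed.

Lemma X_ge3 : (3 <= hdeg X)%N.
Proof. by rewrite hdeg_X. Qed.

Lemma row_free_E : row_free E.
Proof.
apply/row_freeP; exists E^T; apply/matrixP => i j; rewrite !mxE.
rewrite (bigD1 (widen_ord (leqnSn n.+1) i)) //= !mxE eqxx mul1r big1 ?addr0.
  by rewrite -!val_eqE /= eq_sym.
by move=> h hi; rewrite mxE eq_sym (negPf hi) mul0r.
Qed.

Lemma row_free_M : row_free M.
Proof.
have := row_free_E; rewrite -!row_leq_rank /M mxrankMfree //.
by rewrite row_free_unit.
Qed.

Lemma M_v : M *m v = 0.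
Proof. by rewrite /M -mulmxA Tv E_delta. Qed.

(** The substitution x |-> v + x used in [hmult], which moves v to the origin. *)
Let sh : {rmorphism {mpoly k[n.+2]} -> {mpoly k[n.+2]}} :=
  comp_mpoly [tuple (v i 0)%:MP + 'X_i | i < n.+2].

Lemma sh_mx_comp m (A : 'M[k]_(m, n.+2)) i :
  sh (mx_comp A 'X_i) = ((A *m v) i 0)%:MP + mx_comp A 'X_i.
Proof.
rewrite mx_compX rmorph_sum mxE raddf_sum -big_split /=; apply: eq_bigr => j _.
rewrite comp_mpolyZ comp_mpolyXU -tnth_nth tnth_mktuple scalerDr.
by rewrite -mul_mpolyC mpolyCM.
Qed.

Lemma mcoeff0_mx_comp m (A : 'M[k]_(m, n.+2)) i : (mx_comp A 'X_i)@_0%MM = 0.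
Proof.
rewrite mx_compX raddf_sum big1 // => j _.
by rewrite /= mcoeffZ mcoeffX mnm1_eq0 mulr0.
Qed.

Lemma mcoeffU_mx_comp m (A : 'M[k]_(m, n.+2)) i j :
  (mx_comp A 'X_i)@_U_(j) = A i j.
Proof.
rewrite mx_compX raddf_sum (bigD1 j) //= mcoeffZ mcoeffX eqxx mulr1 big1 ?addr0 //.
move=> h hj; rewrite mcoeffZ mcoeffX; case: eqP => [/eqP|]; last by rewrite mulr0.
by rewrite eq_mnm1 (negPf hj).
Qed.

(** As M v = 0, the forms y_0 and y_n are unchanged by the translation, while the orbit product
    takes the value of the product of the [aa i] at the origin. So F(v + x) has no constant term,
    and its linear part is y_0 times a nonzero scalar. *)
Lemma hmult_X : hmult X v = 1%N.
Proof.
rewrite /hmult /= -/(sh F); set Fv := sh F.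
have FvE : Fv =
    mx_comp M 'X_x0 * \prod_i sh (mx_comp (T *m (beta i : 'M[k]_n.+2)) 'X_xt)
  + mx_comp M 'X_x1 * mx_comp M 'X_x1 ^+ #|I|.
  rewrite /Fv FE rmorphD rmorphM rmorph_prod rmorphXn /= !sh_mx_comp M_v.
  by rewrite ![(0 : 'cV__) _ _]mxE !mpolyC0 !add0r -exprS.
have Fv0 : Fv@_0%MM = 0.
  by rewrite FvE rmorphD !rmorphM /= !mcoeff0_mx_comp !mul0r addr0.
(* Pick a variable that occurs in the linear form y_0. *)
have [j Mj] : exists j, M x0 j != 0.
  have : row x0 M != 0.
    have /row_freeP[N MN] := row_free_M.
    apply/eqP => r0; have : row x0 (M *m N) = 0 by rewrite row_mul r0 mul0mx.
    by rewrite MN => /rowP/(_ x0); rewrite !mxE eqxx => /eqP; rewrite oner_eq0.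
  by move=> /matrix0Pn[i [j]]; rewrite mxE => h; exists j.
have Fv1 : Fv@_U_(j) != 0.
  rewrite FvE mcoeffD !mcoeff_U_mul ?mcoeff0_mx_comp // rmorphXn /=.
  rewrite mcoeff0_mx_comp expr0n gtn_eqF ?mulr0 ?addr0; last exact: ltnW.
  rewrite mcoeffU_mx_comp mulf_neq0 // rmorph_prod; apply/prodf_neq0 => i _ /=.
  rewrite sh_mx_comp mcoeffD mcoeff0_mx_comp addr0 mcoeffC eqxx mulr1.
  by rewrite T_beta -mulmxA Tv C_delta !mxE !eqxx mulr1 aa_neq0.
apply/eqP; rewrite eqn_leq; apply/andP; split.
  rewrite -(mdeg1 j); apply: bigmin_le_mem; by rewrite mcoeff_msupp.
rewrite big_seq; elim/big_ind: _ => [|a b|m].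
(* The default value of the minimum is [msize Fv], positive because [Fv] is nonzero. *)
- rewrite lt0n msize_poly_eq0; apply: contraNneq Fv1 => ->; by rewrite mcoeff0.
- by rewrite leq_min => -> ->.
- rewrite lt0n mdeg_eq0; apply: contraTneq => ->.
  by rewrite mcoeff_msupp Fv0 eqxx.
Qed.

(** * The function field of the hypersurface and its Galois group *)

Let J := hideal X.

Lemma mem_J q : q \in J <-> dvdr F q.
Proof. by split=> /asboolP. Qed.

(** Right multiplication by [beta i] permutes the group, hence the factors of the product in
    [FE]. *)
Lemma mx_comp_beta_F i : mx_comp (beta i : 'M[k]_n.+2) F = F.
Proof.
rewrite FE rmorphD rmorphM rmorph_prod rmorphXn /= -!mx_comp_mul M_beta.
have [s sE] : exists s : I -> I, forall j,
    beta (s j) = (beta j * beta i)%g.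
  by exists (fun j => sval (cid (betaM j i))) => j; apply: (svalP (cid (betaM j i))).
have s_inj : injective s.
  by move=> j h /(congr1 beta); rewrite !sE => /mulIg/beta_inj.
rewrite [in RHS](reindex_inj s_inj) /=.
rewrite (eq_bigr (fun j => mx_comp (T *m (beta (s j) : 'M[k]_n.+2)) 'X_xt)) // => j _.
by rewrite -mx_comp_mul sE GLmxM mulmxA.
Qed.

Lemma mem_J_beta i q : (mx_comp (beta i : 'M[k]_n.+2) q \in J) = (q \in J).
Proof.
apply/idP/idP => /mem_J [r er]; apply/mem_J; last first.
  by exists (mx_comp (beta i : 'M[k]_n.+2) r); rewrite er rmorphM /= mx_comp_beta_F.
have [j ej] := betaV i.
exists (mx_comp (beta j : 'M[k]_n.+2) r); rewrite -[in RHS](mx_comp_beta_F j).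
rewrite -rmorphM /= -er -mx_comp_mul -GLmxM ej mulgV mx_comp1 //.
Qed.

(** A polynomial in y_0, ..., y_n is constant in y_t, while F0 has positive degree in y_t; so F0
    divides it only if it is zero. This makes the pullback along [M] well defined. *)
Lemma mem_J_M q : (mx_comp M q \in J) = (q \in pspace_ideal k n).
Proof.
apply/idP/idP => [/mem_J [r er]|/asboolP[r ->]]; last first.
  by rewrite mulr0 rmorph0; apply/mem_J; exists 0; rewrite mul0r.
have e0 : mwiden q = mx_comp (invmx T) r * F0.
  have TI : injective (mx_comp T).
    apply: (can_inj (g := mx_comp (invmx T))) => a.
    by rewrite -mx_comp_mul mulmxV // mx_comp1.
  apply: TI; rewrite rmorphM /= -mx_comp_E -!mx_comp_mul er.
  by rewrite mulVmx // mx_comp1.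
move/(congr1 (@muni n.+1 k)): e0; rewrite muni_mwiden rmorphM /= => e0.
apply/asboolP; exists 0; rewrite mul0r; apply: polyC_eq_mul e0 _.
by rewrite size_muni_F0 /d ltnS ltnW.
Qed.

Let iota_ex := @pullback_ex _ _ _ (pspace_ideal k n) J M (fun _ a _ => mem_J_M a).
Let iota : {rmorphism kP k n -> kX X} := sval (cid iota_ex).
Let iotaP : is_pullback M iota := svalP (cid iota_ex).

Let sg_ex i := @pullback_ex _ _ _ J J (beta i) (fun _ a _ => mem_J_beta i a).
Let sg i : {rmorphism kX X -> kX X} := sval (cid (sg_ex i)).
Let sgP i : is_pullback (beta i : 'M[k]_n.+2) (sg i) := svalP (cid (sg_ex i)).

Lemma sg_iota i a : sg i (iota a) = iota a.
Proof.
have := pullback_comp iotaP (sgP i); rewrite M_beta => h.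
exact: pullback_ext h iotaP a.
Qed.

Lemma sg_bij i : bijective (sg i).
Proof.
have [j ej] := betaV i.
have inv a b : beta a = ((beta b)^-1)%g -> cancel (sg a) (sg b).
  move=> e y; have := pullback_comp (sgP a) (sgP b).
  rewrite -GLmxM e mulVg => h; exact: pullback_ext h (@pullback_id _ _ J) y.
by exists (sg j); apply: inv; rewrite ej ?invgK.
Qed.

Lemma sg_aut i : galois_aut iota (sg i).
Proof. by split; [apply: sg_bij | apply: sg_iota]. Qed.

Let y0 := mx_comp M 'X_x0.
Let yt := mx_comp T 'X_xt.

Lemma y0J : y0 \notin J.
Proof. by rewrite mem_J_M pspace_XU. Qed.

Lemma y0_homog : y0 \is 1.-homog.
Proof. exact/mx_comp_homog/dhomogXU. Qed.

Lemma yt_homog : yt \is 1.-homog.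
Proof. exact/mx_comp_homog/dhomogXU. Qed.

Let z_ex := form_ratio_ex yt_homog y0_homog y0J.
Let z : kX X := sval (cid z_ex).
Let zE : ffval z = form_ratio J yt y0 := svalP (cid z_ex).

Lemma sg_z i : ffval (sg i z) =
  form_ratio J (mx_comp (T *m (beta i : 'M[k]_n.+2)) 'X_xt) y0.
Proof.
have [_ h] := sgP i yt_homog y0_homog y0J.
by rewrite (h _ zE) /y0 /yt -!mx_comp_mul M_beta.
Qed.

(** Equality of two images puts a quadratic form in J, which must vanish, so the rows of
    [T *m beta i] and [T *m beta j] at y_t agree. The other rows are those of [M] in both cases. *)
Lemma sg_z_inj : injective (fun i => sg i z).
Proof.
move=> i j /(congr1 (@ffval _ _ _)); rewrite !sg_z.
move/(form_ratio_eq _ _ y0J y0J); rewrite -mulrBl => h.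
have {h} /eqP : (mx_comp (T *m (beta i : 'M[k]_n.+2)) 'X_xt -
    mx_comp (T *m (beta j : 'M[k]_n.+2)) 'X_xt) * y0 = 0.
  apply: (hideal_homog2 X_ge3) h; apply: (@dhomogM _ _ _ 1%N _ 1%N).
    by apply: rpredB; apply/mx_comp_homog/dhomogXU.
  exact: y0_homog.
rewrite mulf_eq0 => /orP[|/eqP y00]; last first.
  by have := y0J; rewrite y00 idealr0.
rewrite subr_eq0 => /eqP/mx_compX_inj rt; apply: beta_inj; apply: val_inj => /=.
suff : T *m (beta i : 'M[k]_n.+2) = T *m (beta j : 'M[k]_n.+2).
  by move/(congr1 (mulmx (invmx T))); rewrite !mulmxA mulVmx // !mul1mx.
apply/row_matrixP => h; have [->//|ht] := eqVneq h xt.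
have lt_h : (h < n.+1)%N by rewrite ltn_neqAle ht -ltnS ltn_ord.
have wh : widen_ord (leqnSn n.+1) (Ordinal lt_h) = h by apply: val_inj.
have eE (A : 'M[k]_n.+2) : row h A = row (Ordinal lt_h) (E *m A).
  apply/rowP => c; rewrite !mxE (bigD1 h) //= big1 => [|l lh].
    by rewrite mxE wh eqxx mul1r addr0.
  by rewrite mxE wh eq_sym (negPf lh) mul0r.
by rewrite !eE !mulmxA !M_beta.
Qed.

Lemma sg_id : exists i, sg i z = z.
Proof.
have [i ei] := beta1; exists i.
have := sgP i; rewrite ei => h; exact: pullback_ext h (@pullback_id _ _ J) z.
Qed.

Let pq (q : {mpoly k[n.+2]}) := tofrac (quot_proj J q).

(** For a form of degree e this says that a / y_0^e lies in k(P^n)[z], stated with the denominator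
    cleared. *)
Definition in_Kz e (a : {mpoly k[n.+2]}) : Prop :=
  exists q : {poly kP k n}, ffval (map_poly iota q).[z] * pq y0 ^+ e = pq a.

(** In the coordinates of [T], [dhomog_ind] reduces to constants and coordinates: y_t / y_0 is z,
    and every other y_i / y_0 comes from k(P^n). *)
Lemma in_KzP e a : a \is e.-homog -> in_Kz e a.
Proof.
have pq0 : pq y0 != 0 by apply: quot_proj_neq0 y0J.
move=> ha; suff h b : b \is e.-homog -> in_Kz e (mx_comp T b).
  have := h _ (mx_comp_homog (invmx T) ha).
  by rewrite -mx_comp_mul mulVmx // mx_comp1.
have iotaK (c g : {mpoly k[n.+1]}) f : c \is f.-homog -> g \is f.-homog ->
    g != 0 -> exists x, ffval (iota x) = form_ratio J (mx_comp M c) (mx_comp M g).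
  move=> hc hg g0; have gI : g \notin pspace_ideal k n.
    by apply/negP => /asboolP[q eg]; rewrite eg mulr0 eqxx in g0.
  have [x ex] := form_ratio_ex hc hg gI; exists x.
  by have [_ h] := iotaP hc hg gI; rewrite (h _ ex).
move: e b {ha}; apply: dhomog_ind =>
  [f|f a1 a2 [q1 e1] [q2 e2]|f1 f2 a1 a2 [q1 e1] [q2 e2]|c|i].
- by exists 0; rewrite rmorph0 horner0 rmorph0 /pq !rmorph0 mul0r.
- exists (q1 + q2); rewrite rmorphD hornerD /pq !rmorphD /= mulrDl.
  by rewrite e1 e2.
- exists (q1 * q2); rewrite rmorphM hornerM /pq !rmorphM /= exprD mulrACA.
  by rewrite e1 e2.
- have [x ex] := iotaK _ _ _ (mpolyC_homog _ c) (dhomog1 _ _) (oner_neq0 _).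
  exists x%:P; rewrite map_polyC hornerC ex expr0 mulr1 /form_ratio.
  by rewrite !rmorph1 divr1 !mx_compC.
- have [->|it] := eqVneq i xt.
    exists 'X; rewrite map_polyX hornerX zE expr1 /form_ratio -/(pq _) -/(pq y0).
    by rewrite divfK.
  have lt_i : (i < n.+1)%N by rewrite ltn_neqAle it -ltnS ltn_ord.
  have [x ex] := iotaK _ _ _ (dhomogXU k (Ordinal lt_i)) (dhomogXU k x0)
    (mpolyXU_neq0 _ _).
  exists x%:P; rewrite map_polyC hornerC ex expr1 /form_ratio -/(pq _) -/(pq _) -/y0.
  rewrite divfK //; congr pq; rewrite /M mx_comp_mul mx_comp_E; congr mx_comp.
  by rewrite mwidenX mnmwiden1; congr 'X_[U_(_)]; apply: val_inj.
Qed.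

(** Divide numerator and denominator of the fraction by the same power of y_0. *)
Lemma gen_z y : exists q r : {poly kP k n},
  y = (map_poly iota q).[z] / (map_poly iota r).[z].
Proof.
have pq0 : pq y0 != 0 by apply: quot_proj_neq0 y0J.
have [e [a [b [ha hb bJ ey]]]] := funfieldP y.
have [[q eq] [r er]] := (in_KzP ha, in_KzP hb).
exists q, r; apply: val_inj => /=; rewrite ey /form_ratio -/(pq a) -/(pq b) -eq -er.
by rewrite -mulf_div divff ?mulr1 ?expf_neq0 // fmorph_div.
Qed.

Lemma ww_homog i : ww i \is 1.-homog.
Proof. by apply: rpred_sum => j _; apply/dhomogZ/dhomogXU. Qed.

Lemma one_pspace : 1 \notin pspace_ideal k n.
Proof. by rewrite idealr1. Qed.

(** [al i], [wl i] and [t1] are the functions aa_i, ww_i / y_0 and y_n / y_0 on P^n, from which the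
    equation [f] of z is built. *)
Let al_ex i := form_ratio_ex (mpolyC_homog n.+1 (aa i)) (dhomog1 _ _) one_pspace.
Let al i : kP k n := sval (cid (al_ex i)).
Let wl_ex i := form_ratio_ex (ww_homog i) (dhomogXU k x0) (pspace_XU k x0).
Let wl i : kP k n := sval (cid (wl_ex i)).
Let t1_ex := form_ratio_ex (dhomogXU k x1) (dhomogXU k x0) (pspace_XU k x0).
Let t1 : kP k n := sval (cid t1_ex).

Lemma al_neq0 i : al i != 0.
Proof.
apply/eqP => a0; have := svalP (cid (al_ex i)); rewrite -/(al i) a0 ffval0.
rewrite /form_ratio !rmorph1 divr1 => /esym/eqP; rewrite tofrac_eq0 quot_proj_eq0.
move=> /asboolP[q /eqP]; rewrite mulr0 mpolyC_eq0.
by rewrite (negPf (aa_neq0 i)).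
Qed.

Let f : {poly kP k n} := prod_linear al wl (t1 ^+ d).

Lemma size_f : size f = #|I|.+1.
Proof. exact: (size_prod_linearD wl (t1 ^+ d) (ltnW I_gt1) al_neq0). Qed.

Lemma pqM a b : pq (a * b) = pq a * pq b.
Proof. by rewrite /pq !rmorphM. Qed.
Lemma pqD a b : pq (a + b) = pq a + pq b.
Proof. by rewrite /pq !rmorphD. Qed.
Lemma pqX a m : pq (a ^+ m) = pq a ^+ m.
Proof. by rewrite /pq !rmorphXn. Qed.
Lemma pq_prod (a : I -> {mpoly k[n.+2]}) : pq (\prod_i a i) = \prod_i pq (a i).
Proof. by rewrite /pq !rmorph_prod. Qed.

Lemma pq_y0 : pq y0 != 0.
Proof. by apply: quot_proj_neq0 y0J. Qed.

Lemma ffval_iota x a b e : a \is e.-homog -> b \is e.-homog ->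
  b \notin pspace_ideal k n -> ffval x = form_ratio (pspace_ideal k n) a b ->
  ffval (iota x) = pq (mx_comp M a) / pq (mx_comp M b).
Proof. by move=> ha hb hbI ex; have [_ h] := iotaP ha hb hbI; rewrite (h _ ex). Qed.

Lemma iota_al i : ffval (iota (al i)) = pq (aa i)%:MP.
Proof.
rewrite (ffval_iota (mpolyC_homog _ _) (dhomog1 _ _) one_pspace
  (svalP (cid (al_ex i)))).
by rewrite mx_compC /pq !rmorph1 divr1.
Qed.

Lemma iota_wl i : ffval (iota (wl i)) * pq y0 = pq (mx_comp M (ww i)).
Proof.
rewrite (ffval_iota (ww_homog i) (dhomogXU k x0) (pspace_XU k x0) (svalP (cid (wl_ex i)))).
by rewrite divfK // pq_y0.
Qed.

Lemma iota_t1 : ffval (iota t1) * pq y0 = pq (mx_comp M 'X_x1).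
Proof.
rewrite (ffval_iota (dhomogXU k x1) (dhomogXU k x0) (pspace_XU k x0) (svalP (cid t1_ex))).
by rewrite divfK // pq_y0.
Qed.

Lemma iota_g i : ffval (iota (al i) * z + iota (wl i)) * pq y0 =
  pq (mx_comp (T *m (beta i : 'M[k]_n.+2)) 'X_xt).
Proof.
rewrite ffvalD ffvalM mulrDl iota_wl iota_al zE -mulrA.
rewrite [form_ratio _ _ _ * _]divfK ?pq_y0 // -pqM -pqD; congr pq.
rewrite T_beta mx_comp_mul mx_comp_C (rmorphD (mx_comp T)) /=.
by rewrite mx_compZ mul_mpolyC /M mx_comp_mul mx_comp_E.
Qed.

(** Multiplying f(z) by y_0^d gives the class of F in the coordinate ring, which is zero. *)
Lemma root_f : root (map_poly iota f) z.
Proof.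
have fz := horner_prod_linear al wl (t1 ^+ d) iota z.
have pqF : pq F = 0.
  by apply/eqP; rewrite tofrac_eq0 quot_proj_eq0; apply/mem_J; exists 1; rewrite mul1r.
have fz0 : ffval (map_poly iota f).[z] * pq y0 ^+ d = 0.
  rewrite fz rmorphXn ffvalD ffval_prod ffvalX mulrDl -exprMn iota_t1 -[RHS]pqF.
  rewrite FE pqD pqM pq_prod pqX.
  rewrite [in RHS](eq_bigr (fun i =>
    ffval (iota (al i) * z + iota (wl i)) * pq y0)) => [|i _]; last first.
    by rewrite iota_g.
  by rewrite big_split prodr_const /= mulrCA -exprS.
apply/rootP/val_inj; rewrite [RHS]ffval0; move/eqP: fz0.
by rewrite mulf_eq0 (negPf (expf_neq0 d pq_y0)) orbF => /eqP.
Qed.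

Lemma galois_iota : is_galois iota.
Proof.
exact: (is_galois_simple sg_iota sg_z_inj sg_id size_f root_f gen_z).
Qed.

(** An automorphism over k(P^n) is determined by its value at z, and that value is some [sg i z]. *)
Lemma galois_aut_sg (s : {rmorphism kX X -> kX X}) :
  galois_aut iota s -> exists i, s =1 sg i.
Proof.
move=> sgal; have [i si] := galois_aut_simple sg_iota sg_z_inj size_f root_f sgal.
have [_ sK] := sgal; exists i => y; have [q [r ->]] := gen_z y.
have E' (s' : {rmorphism kX X -> kX X}) p : (forall a, s' (iota a) = iota a) ->
    s' (map_poly iota p).[z] = (map_poly iota p).[s' z].
  move=> s'K; rewrite -horner_map -map_poly_comp; congr (_.[_]).
  by apply: eq_map_poly => a; rewrite /= s'K.
by rewrite !fmorph_div !E' ?si //; apply: sg_iota.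
Qed.

Lemma preserves_X i : preserves (beta i : 'M[k]_n.+2) X.
Proof.
move=> x; suff -> : (heqn X).@[fun j => ((beta i : 'M[k]_n.+2) *m x) j 0] =
  (heqn X).@[fun j => x j 0] by [].
transitivity (mx_comp (beta i : 'M[k]_n.+2) F).@[fun j => x j 0].
  by rewrite meval_mx_comp; apply: meval_eq => j; rewrite mxE.
by rewrite mx_comp_beta_F.
Qed.

Lemma galois_construction (G : {pred PGL k n.+2}) :
  (forall h, h \in G <-> exists i, pr (beta i) = h) ->
  exists (X : hypersurface k n.+1) (P : 'cV[k]_n.+2)
    (iota : {rmorphism kP k n -> kX X}),
    [/\ hdeg X = #|I|.+1, hmult X P = 1%N, galois_point P iota,
        extendable iota & is_galois_group iota G].
Proof.
move=> GP; exists X, v, iota; split; [exact: hdeg_X|exact: hmult_X| | |].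
- split; [exact: v_neq0 | by rewrite hmult_X hdeg_X /d ltnS ltnW | | exact: galois_iota].
  apply: (ex_intro2 _ _ M _ iotaP); split; last exact: M_v.
  exact/eqP/row_free_M.
- move=> s /galois_aut_sg[i si]; exists (pr (beta i)), (beta i); split=> //.
    exact: preserves_X.
  by apply: pullback_eq (sgP i) => y; rewrite si.
- move=> h; rewrite GP; split=> [[i <-]|[s /galois_aut_sg[i si] [A [<- _ pA]]]].
    exists (sg i); first exact: sg_aut.
    by exists (beta i); split; [| exact: preserves_X | exact: sgP].
  exists i; have pAi : is_pullback (A : 'M[k]_n.+2) (sg i) by apply: pullback_eq pA.
  (* [A] and [beta i] induce the same pullback, and X has degree at least 3, so the matrices are
     proportional. *)
  have [c e] : exists c, (A : 'M[k]_n.+2) = c *: (beta i : 'M[k]_n.+2).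
    apply: (pullback_unique _ _ _ _ pAi (sgP i)) => //.
    + by move=> j; apply/hideal_XU/X_ge3.
    + by move=> q; apply/hideal_homog2/X_ge3.
    + by rewrite row_free_unit Defs.GL_unit.
  apply/esym/prP; exists c => //; apply/eqP => c0.
  move: (Defs.GL_unit A); rewrite e c0 scale0r => /mulmxV/matrixP/(_ 0 0).
  by rewrite mul0mx !mxE eqxx => /eqP; rewrite eq_sym oner_eq0.
Qed.

End Construction.

(** * From a lift with a common image to the construction *)

(** The finite group S indexes both G and G'; its order is that of K times that of H, and p divides
    p^u because u is positive. *)
Lemma iso_sdprod_lift (k : fieldType) (r p u l : nat) (G : {pred PGL k r})
    (G' : {pred GL k r}) : prime p -> (0 < u)%N ->
  iso_elementary_sdprod p u l G -> group_closed G' -> pr_isom G' G ->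
  exists (I : finType) (beta : I -> GL k r), [/\ (p %| #|I|)%N, (0 < #|I|)%N,
    injective beta, forall A, A \in G' <-> exists i, beta i = A
    & forall g, g \in G <-> exists i, pr (beta i) = g].
Proof.
move=> pP u0 [gT [S [K [H [phi [defS isoK isoH [phiM phiI] GP]]]]]] [G'1 G'V] [prI prS].
have cardK : #|K| = (p ^ u)%N.
  by rewrite (card_isog isoK) cardsT card_mx mul1n card_ord (Zp_cast (prime_gt1 pP)).
have ex (s : subg_of S) : exists A, A \in G' /\ pr A = phi (sgval s).
  have /prS[A AG' eA] : phi (sgval s) \in G by apply/GP; exists (sgval s); rewrite ?subgP.
  by exists A.
pose beta s := sval (cid (ex s)).
have bG' s : beta s \in G' by have [] := svalP (cid (ex s)).
have prb s : pr (beta s) = phi (sgval s) by have [] := svalP (cid (ex s)).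
exists (subg_of S), beta; split.
- have -> : #|subg_of S| = #|S| by rewrite card_sub; apply: eq_card => x; rewrite inE.
  by rewrite -(sdprod_card defS) cardK dvdn_mulr // dvdn_exp.
- by apply/card_gt0P; exists (subg S 1%g).
- move=> s t est; apply: val_inj; apply: (phiI _ _ (subgP s) (subgP t)).
  by rewrite -!prb est.
- move=> A; split=> [AG'|[i <-]]; last exact: bG'.
  have /GP[s sS es] : pr A \in G by apply/prS; exists A.
  by exists (subg S s); apply: prI => //; rewrite prb subgK.
- move=> g; rewrite GP; split=> [[s sS <-]|[i <-]].
    by exists (subg S s); rewrite prb subgK.
  by exists (sgval i); rewrite ?subgP // prb.
Qed.

(** The image of A - 1 is a line, so it is spanned by any nonzero column, found as a nonzero row of
    the transpose; for B = 1 the factor w is 0. *)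
Lemma common_image_vector (k : fieldType) r (G' : {pred GL k r}) :
  (exists2 A : GL k r, A \in G' & \rank ((A : 'M[k]_r) - 1%:M) = 1%N) ->
  (forall B C : GL k r, B \in G' -> C \in G' -> B != 1%g -> C != 1%g ->
     same_image ((B : 'M[k]_r) - 1%:M) ((C : 'M[k]_r) - 1%:M)) ->
  exists2 v : 'cV[k]_r, v != 0 &
    forall B : GL k r, B \in G' -> exists w, (B : 'M[k]_r) - 1%:M = v *m w.
Proof.
move=> [A AG' rA] im; have A1 : A != 1%g.
  by apply: contra_eq_neq rA => ->; rewrite GLmx1 subrr mxrank0.
pose N := ((A : 'M[k]_r) - 1%:M)^T.
have rN : \rank N = 1%N by rewrite mxrank_tr.
have N0 : N != 0 by rewrite -mxrank_eq0 rN.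
have Nsub : (N <= nz_row N)%MS.
  by rewrite -(geq_leqif (mxrank_leqif_sup (nz_row_sub N))) rN rank_rV nz_row_eq0 N0.
exists (nz_row N)^T; first by rewrite trmx_eq0 nz_row_eq0.
move=> B BG'; have [->|B1] := eqVneq B 1%g.
  by exists 0; rewrite mulmx0 GLmx1 subrr.
have /submxP[D eD] : (((B : 'M[k]_r) - 1%:M)^T <= nz_row N)%MS.
  by rewrite (im B A BG' AG' B1 A1).
by exists D^T; rewrite -trmx_mul -eD trmxK.
Qed.

Theorem theorem1p3 (k : closedFieldType) (p : nat) (pchark : p \in [pchar k])
    (n : nat) (n_ge1 : (1 <= n)%N)
    (u l : nat) (u_ge1 : (1 <= u)%N) (l_ge1 : (1 <= l)%N)
    (copl : (2 <= l)%N -> coprime p l)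
    (G : {pred PGL k n.+2}) (G_group : group_closed G)
    (G_sdprod : iso_elementary_sdprod p u l G) :
  liftable G
  /\
  ((exists (X : hypersurface k n.+1) (P : 'cV[k]_n.+2)
      (iota : {rmorphism kP k n -> kX X}),
      [/\ (3 <= hdeg X)%N, galois_point P iota,
          (p %| hdeg X - hmult X P)%N, extendable iota
        & is_galois_group iota G])
   <->
   (exists G' : {pred GL k n.+2},
      [/\ group_closed G', pr_isom G' G,
          exists2 A : GL k n.+2, A \in G' & \rank ((A : 'M[k]_n.+2) - 1%:M) = 1%N
        & forall B C : GL k n.+2, B \in G' -> C \in G' ->
            B != 1%g -> C != 1%g ->
            same_image ((B : 'M[k]_n.+2) - 1%:M) ((C : 'M[k]_n.+2) - 1%:M)])).
Proof.
have pP : prime p := pcharf_prime pchark.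
split; first exact: liftable_sdprod pchark _ _ _ G_sdprod.
split=> [[X [P [iota [X3 [_ _ pM _] _ _ galG]]]]|[G' [grG' isoG' exA im]]].
  have [G' [grG' isoG' im]] := galois_group_lift n_ge1 X3 galG G_group pM.
  exists G'; split=> // [|B C BG' CG' B1 C1]; last first.
    by have [_] := im B C BG' CG' B1 C1.
  (* Any nontrivial element of G' has B - 1 of rank 1, so condition (i) only needs G to be
     nontrivial. *)
  have [g gG g1] := sdprod_nontrivial pP u_ge1 G_sdprod.
  have [A AG' eA] := (isoG'.2 g).1 gG; exists A => //.
  have A1 : A != 1%g by apply: contraNneq g1 => A1; rewrite -eA A1 pr1g.
  by have [] := im A A AG' AG' A1 A1.
have [v v0 imv] := common_image_vector exA im.
have [I [beta [pI I0 bI bG' GP]]] := iso_sdprod_lift pP u_ge1 G_sdprod grG' isoG'.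
have I1 : (1 < #|I|)%N := leq_trans (prime_gt1 pP) (dvdn_leq I0 pI).
have [G'1 G'D] := grG'.
have bG i : beta i \in G' by apply/bG'; exists i.
have G'V A : A \in G' -> (A^-1)%g \in G'.
  by move=> AG'; rewrite -[(A^-1)%g]mul1g; apply: G'D.
have [T TU Tv] := unitmx_to_delta ord_max v0.
have [] := @galois_construction k n n_ge1 I beta v I1 bI _ _ _ v0 _ T TU Tv G GP.
- exact/bG'.
- by move=> i j; apply/bG'; rewrite -[beta j]invgK; apply: G'D (bG i) (G'V _ (bG j)).
- by move=> i; apply/bG'/G'V/bG.
- by move=> i; apply/imv/bG.
move=> X [P [iota [dX mX gP eX galG]]]; exists X, P, iota; split=> //.
  by rewrite dX.
(* The degree minus the multiplicity is [#|I|], which p divides. *)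
by rewrite dX mX subn1.
Qed.
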